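(* Let $\nu>0$, let $0\le F\in V'$, and let $U\subset V'$ and $U_{\mathrm{ad}}\subset U$ be such that $U_{\mathrm{ad}}$ is nonempty and $$U_{\mathrm{ad}}\subset\{f\in L^\infty_\nu(\Omega): f\le F\}.$$ Suppose that (i) $J_1:V\times V\to\mathbb{R}$ is weakly lower semicontinuous; and that either (ii) $J_2:L^\infty(\Omega)\to\mathbb{R}$ is continuous, and $U_{\mathrm{ad}}$ is closed in $L^\infty(\Omega)$, or (ii') $U$ is a reflexive Banach space, $J_2:U\to\mathbb{R}$ is coercive and weakly lower semicontinuous, and $U_{\mathrm{ad}}$ is weakly closed in $U$. Suppose both $J_1$ and $J_2$ are bounded from below, and that for each $\alpha>0$ the set $\{f\in U_{\mathrm{ad}}:J_2(f)\le\alpha\}$ is sequentially compact in $L^\infty(\Omega)$. Assume additionally that the increasing map $\Phi:H^+\to H^+$ satisfies Assumption (A) (stated in the context) and that $\lambda\Phi(y)\ge\Phi(\lambda y)$ for any $\lambda>1$ and any $y\in H^+$. Then the problem $$\text{minimize } J_1(\mathbf{m}(f),\mathbf{M}(f))+J_2(f)\quad\text{subject to } f\in U_{\mathrm{ad}}\qquad(\tilde{\mathbb{P}})$$ admits a solution, and hence so does the problem $$\text{minimize } J_1(T_{\sup}(\mathbf{O}),T_{\inf}(\mathbf{O}))+J_2(f)\ \text{ over } (\mathbf{O},f)\in 2^H\times U,\ \text{ subject to } f\in U_{\mathrm{ad}},\ \mathbf{O}=\mathbf{Q}(f).\qquad(\mathbb{P})$$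
   Context: $(V,H,V')$ is a Gelfand triple of Hilbert spaces: $V\hookrightarrow H\hookrightarrow V'$ with dense and continuous embeddings, $H$ identified with $H'$; $\langle\cdot,\cdot\rangle$ is the duality pairing of $V'$ and $V$, $(\cdot,\cdot)$ the inner product of $H$. $H^+\subset H$ is a closed convex cone with $H^+=\{v\in H:(v,y)\ge0\ \forall y\in H^+\}$, and $x\le y$ means $y-x\in H^+$. For $x\in H$, $x^+$ is the orthogonal projection of $x$ onto $H^+$ and $x^-:=x^+-x$; $\sup(x,y):=x+(y-x)^+$, $\inf(x,y):=x-(x-y)^+$. It is assumed that $y\in V$ implies $y^+\in V$, and $\|y^+\|_V\le M\|y\|_V$ for all $y\in V$ and some $M>0$. $V$ and $H$ are spaces of functions $h:\Omega\to\mathbb{R}$ on an open set $\Omega\subset\mathbb{R}^N$, with $L^\infty(\Omega)\hookrightarrow H$ densely and continuously, and $L^\infty(\Omega)$ inherits the order of $H$ (prototype: $V=H_0^1(\Omega)$, $H=L^2(\Omega)$, $H^+$ the a.e. non-negative functions). In $V'$, $f_1\le f_2$ means $\langle f_2-f_1,v\rangle\ge0$ for all $v\in V$ with $v\ge0$. $L^\infty_\nu(\Omega):=\{z\in L^\infty(\Omega): z(x)\ge\nu \text{ for a.a. } x\in\Omega\}$. For $x\le y$ in $H$, $[x,y]:=\{z\in H:x\le z\le y\}$. The inclusion $U\subset V'$ is understood as a continuous inclusion when $U$ is a Banach space. $A:V\to V'$ (possibly nonlinear) is: homogeneous of order one ($A(tu)=tA(u)$ for $u\in V$, $t>0$); Lipschitz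 continuous ($\|A(u)-A(v)\|_{V'}\le C\|u-v\|_V$); strongly monotone ($\langle A(u)-A(v),u-v\rangle\ge c\|u-v\|_V^2$ for some $c>0$); and T-monotone ($\langle A(u)-A(v),(u-v)^+\rangle\ge0$ for all $u,v\in V$, with equality if and only if $(u-v)^+=0$). $\Phi:H^+\to H^+$ is increasing ($0\le v\le w$ implies $\Phi(v)\le\Phi(w)$), extended to $H$ by $x\mapsto\Phi(x^+)$ when needed. For $\psi\in H^+$, $\mathbf{K}(\psi):=\{v\in V:v\le\psi\}$; for $f\in V'$, $S(f,\psi)$ is the unique $y\in\mathbf{K}(\psi)$ with $\langle A(y)-f,v-y\rangle\ge0$ for all $v\in\mathbf{K}(\psi)$. $\mathbf{Q}(f)$ is the set of solutions of the quasi-variational inequality: find $y\in\mathbf{K}(\Phi(y))$ with $\langle A(y)-f,v-y\rangle\ge0$ for all $v\in\mathbf{K}(\Phi(y))$ (equivalently, the fixed points of $y\mapsto S(f,\Phi(y))$). Let $\underline{y}=0$ and let $\overline{y}\in V$ be the unique solution of $A(\overline{y})=F$. For $f\in V'$ with $0\le f\le F$, the set $\mathbf{Q}(f)\cap[\underline{y},\overline{y}]$ is non-empty and has a smallest element $\mathbf{m}(f)$ and a largest element $\mathbf{M}(f)$, both in $V$. For $\mathbf{O}\subset H$, $T_{\sup}(\mathbf{O}):=\sup_{z\in\mathbf{O}\cap[\underline{y},\overline{y}]}z$ if $\mathbf{O}\cap[\underline{y},\overline{y}]\neq\emptyset$ and $T_{\sup}(\mathbf{O}):=\underline{y}$ otherwise;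 $T_{\inf}(\mathbf{O}):=\inf_{z\in\mathbf{O}\cap[\underline{y},\overline{y}]}z$ if $\mathbf{O}\cap[\underline{y},\overline{y}]\neq\emptyset$ and $T_{\inf}(\mathbf{O}):=\overline{y}$ otherwise. Thus $T_{\sup}(\mathbf{Q}(f))=\mathbf{M}(f)$ and $T_{\inf}(\mathbf{Q}(f))=\mathbf{m}(f)$. Assumption (A): $\Phi$ satisfies one of the following. (a) Whenever $v_n\rightharpoonup v$ in $V$, either $\Phi(v_n)\to\Phi(v)$ in $L^\infty_\nu(\Omega)$ (i.e. these elements lie in $L^\infty_\nu(\Omega)$ and converge in $L^\infty(\Omega)$), or $\Phi(v_n)\to\Phi(v)$ in $V$. (b) Whenever $v_n\rightharpoonup v$ in $V$, $\Phi(v_n)\to\Phi(v)$ in $H$; and there is a strongly monotone $\mathcal{Q}\in\mathscr{L}(V,V')$ (bounded linear) with $\langle\mathcal{Q}v^-,v^+\rangle\le0$ for all $v\in V$ such that for every $v\in V\cap H^+$ one has $\Phi(v)\in V$ and $\mathcal{Q}\Phi(v)\ge0$ in $V'$. *)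

(* Defs.v *)
From HB Require Import structures.
From mathcomp Require Import all_boot all_order all_algebra.
From mathcomp Require Import all_classical all_reals all_analysis.
From mathcomp Require Import sesquilinear.

Set Implicit Arguments.
Unset Strict Implicit.
Unset Printing Implicit Defensive.

Import Order.TTheory GRing.Theory Num.Theory.
Import numFieldNormedType.Exports.

Local Open Scope classical_set_scope.
Local Open Scope ring_scope.

Section Duality.
Context {R : realType}.

Record topdual (X : normedModType R) := Dual {
  dual_form :> {scalar X};
  dual_continuous : continuous (dual_form : X -> R)
}.

Implicit Types X Y : normedModType R.

(* A [sup] of reals, hence only meaningful for bounded functionals; it is
   taken of bare functions so that it applies to differences [f - g] of
   elements of the dual, which carries no algebraic structure here. *)
Definition dual_norm X (f : X -> R) : R :=
  sup [set `|f x| | x in [set x : X | `|x| <= 1]].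

Definition weak_cvg X (x_ : nat -> X) (x : X) : Prop :=
  forall f : topdual X, (fun n => f (x_ n)) @ \oo --> f x.

(* Weak closedness and weak lower semicontinuity are sequential; both follow
   from the corresponding notions for the weak topology. *)
Definition weakly_closed X (S : set X) : Prop :=
  forall (x_ : nat -> X) (x : X),
    (forall n, S (x_ n)) -> weak_cvg x_ x -> S x.

Definition weakly_lsc X (J : X -> R) : Prop :=
  forall (x_ : nat -> X) (x : X), weak_cvg x_ x ->
    ((J x)%:E <= limn_einf (fun n => (J (x_ n))%:E))%E.

Definition coercive X (J : X -> R) : Prop :=
  forall c : R, exists r : R, forall x : X, r <= `|x| -> c <= J x.

Definition dual_linear X Y (j : X -> topdual Y) : Prop :=
  forall (a : R) (x y : X) (v : Y), j (a *: x + y) v = a * j x v + j y v.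

Definition dual_bounded X Y (j : X -> topdual Y) : Prop :=
  exists C : R, forall x : X, dual_norm (j x) <= C * `|x|.

Definition reflexive_space X : Prop :=
  forall G : topdual X -> R,
    (forall (a : R) (f g h : topdual X),
       (forall x, h x = a * f x + g x) -> G h = a * G f + G g) ->
    (exists C : R, forall f : topdual X, `|G f| <= C * dual_norm f) ->
    exists x : X, forall f : topdual X, G f = f x.

Definition bounded_below {T : Type} (J : T -> R) : Prop :=
  exists c : R, forall x, c <= J x.

Definition is_minimizer {T : Type} (D : set T) (J : T -> R) (x : T) : Prop :=
  D x /\ forall y, D y -> J x <= J y.

End Duality.

Section Linfty.
Context {R : realType} {N : nat}.

Definition borelRn : Type := g_sigma_algebraType (@open 'rV[R]_N).
HB.instance Definition _ := Measurable.on borelRn.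

(* By uniqueness of measure extension these values on boxes determine [mu]. *)
Definition is_lebesgue (mu : {measure set borelRn -> \bar R}) : Prop :=
  forall a b : 'rV[R]_N, (forall i, a 0 i <= b 0 i) ->
    mu [set x : 'rV[R]_N | forall i, a 0 i <= x 0 i <= b 0 i] =
    (\prod_(i < N) (b 0 i - a 0 i))%:E.

Lemma open_measurable_borelRn (O : set 'rV[R]_N) :
  open O -> measurable (O : set borelRn).
Proof. exact: sub_sigma_algebra. Qed.

Variables (mu : {measure set borelRn -> \bar R}) (O : set 'rV[R]_N).
Hypothesis oO : open O.

(* The restricted measure lives on the whole space and ignores the complement
   of [O]: "a.e. for [restr_measure]" means "a.e. on [O]". *)
Definition restr_measure : {measure set borelRn -> \bar R} :=
  mrestr mu (open_measurable_borelRn oO).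

End Linfty.

(* Elements are representatives: two of them denote the same class when they
   are equal almost everywhere on the open set, i.e. when the [Linfty_norm] of
   their difference is 0. *)
Notation Linfty mu oO :=
  (LfunType (restr_measure mu oO) (leey 1 : (1 <= +oo)%E)).

Section LinftyTopology.
Context {R : realType} {N : nat} {mu : {measure set @borelRn R N -> \bar R}}.
Context {O : set 'rV[R]_N} {oO : open O}.
Implicit Types z : Linfty mu oO.

Definition Linfty_norm z : R :=
  fine ('N[restr_measure mu oO]_+oo [EFin \o z])%E.

Definition Linfty_cvg (z_ : nat -> Linfty mu oO) z : Prop :=
  (fun n => Linfty_norm (z_ n - z)) @ \oo --> (0 : R).

Definition Linfty_ge (nu : R) : set (Linfty mu oO) :=
  [set z | {ae restr_measure mu oO, forall x, nu <= z x}].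

Definition Linfty_closed (S : set (Linfty mu oO)) : Prop :=
  forall z, (forall e, 0 < e -> exists2 y, S y & Linfty_norm (y - z) < e) ->
  S z.

Definition Linfty_continuous (J : Linfty mu oO -> R) : Prop :=
  forall z e, 0 < e -> exists2 d, 0 < d &
    forall y, Linfty_norm (y - z) < d -> `|J y - J z| < e.

Definition Linfty_seq_compact (S : set (Linfty mu oO)) : Prop :=
  forall z_ : nat -> Linfty mu oO, (forall n, S (z_ n)) ->
  exists (phi : nat -> nat) z,
    [/\ {homo phi : m n / (m < n)%N}, S z & Linfty_cvg (z_ \o phi) z].

End LinftyTopology.

Section Order.
Context {R : realType} {H : completeNormedModType R}.
Variable C : set H.

Definition cone_le (x y : H) : Prop := C (y - x).

Definition proj_on (x : H) : H :=
  xget 0 [set p | C p /\ forall q, C q -> `|x - p| <= `|x - q|].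

Definition cone_sup (x y : H) : H := x + proj_on (y - x).

End Order.

(* The injection [emb] is the inclusion of V in H, and [fn] realizes the
   elements of H (hence those of V) as functions, determined up to equality
   a.e. on [Omega]. [embLinfty] is the inclusion of L^oo(Omega) in H; it
   identifies representatives that are equal a.e. on [Omega]. *)
Record qvi_setting (R : realType) (N : nat) := QviSetting {
  mu : {measure set @borelRn R N -> \bar R};
  mu_lebesgue : is_lebesgue mu;
  Omega : set 'rV[R]_N;
  Omega_open : open Omega;

  spaceV : completeNormedModType R;
  dotV : {dot spaceV for idfun};
  dotV_norm : forall v : spaceV, `|v| ^+ 2 = dotV v v;
  spaceH : completeNormedModType R;
  dotH : {dot spaceH for idfun};
  dotH_norm : forall x : spaceH, `|x| ^+ 2 = dotH x x;

  emb : {linear spaceV -> spaceH};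
  emb_inj : injective emb;
  emb_continuous : continuous emb;
  emb_dense : dense (range emb);

  Hpos : set spaceH;
  Hpos_closed : closed Hpos;
  Hpos_add : forall x y : spaceH, Hpos x -> Hpos y -> Hpos (x + y);
  Hpos_scale : forall (a : R) (x : spaceH), 0 <= a -> Hpos x -> Hpos (a *: x);
  Hpos_selfdual : Hpos = [set v | forall y, Hpos y -> 0 <= dotH v y];
  (* [cone_sup x y] is always an upper bound of [x] and [y], but for a general
     self-dual cone (e.g. the Lorentz cone) it need not be the least one. *)
  Hpos_lattice : forall x y z : spaceH,
    cone_le Hpos x z -> cone_le Hpos y z -> cone_le Hpos (cone_sup Hpos x y) z;

  ppart_V : forall y : spaceV, exists z : spaceV, emb z = proj_on Hpos (emb y);
  ppart_bounded : exists2 M : R, 0 < M &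
    forall y z : spaceV, emb z = proj_on Hpos (emb y) -> `|z| <= M * `|y|;

  fn : spaceH -> 'rV[R]_N -> R;
  fn_linear : forall (a : R) (x y : spaceH),
    {ae restr_measure mu Omega_open, forall t,
       fn (a *: x + y) t = a * fn x t + fn y t};
  fn_inj : forall x : spaceH,
    {ae restr_measure mu Omega_open, forall t, fn x t = 0} -> x = 0;

  embLinfty : {linear Linfty mu Omega_open -> spaceH};
  embLinfty_fn : forall z : Linfty mu Omega_open,
    {ae restr_measure mu Omega_open, forall t, fn (embLinfty z) t = z t};
  embLinfty_continuous : exists C : R, forall z : Linfty mu Omega_open,
    `|embLinfty z| <= C * Linfty_norm z;
  embLinfty_dense : dense (range embLinfty);
  embLinfty_order : forall z : Linfty mu Omega_open,
    Hpos (embLinfty z) <-> Linfty_ge 0 z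
}.

Arguments mu {R N} _.
Arguments mu_lebesgue {R N} _.
Arguments Omega {R N} _.
Arguments Omega_open {R N} _.
Arguments spaceV {R N} _.
Arguments dotV {R N} _.
Arguments dotV_norm {R N} _.
Arguments spaceH {R N} _.
Arguments dotH {R N} _.
Arguments dotH_norm {R N} _.
Arguments emb {R N} _.
Arguments emb_inj {R N} _.
Arguments emb_continuous {R N} _.
Arguments emb_dense {R N} _.
Arguments Hpos {R N} _.
Arguments Hpos_closed {R N} _.
Arguments Hpos_add {R N} _.
Arguments Hpos_scale {R N} _.
Arguments Hpos_selfdual {R N} _.
Arguments Hpos_lattice {R N} _.
Arguments ppart_V {R N} _.
Arguments ppart_bounded {R N} _.
Arguments fn {R N} _.
Arguments fn_linear {R N} _.
Arguments fn_inj {R N} _.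
Arguments embLinfty {R N} _.
Arguments embLinfty_fn {R N} _.
Arguments embLinfty_continuous {R N} _.
Arguments embLinfty_dense {R N} _.
Arguments embLinfty_order {R N} _.

Section Problem.
Context {R : realType} {N : nat} {S : qvi_setting R N}.
Local Notation V := (spaceV S).
Local Notation H := (spaceH S).
Implicit Types (x y h psi : H) (u v w : V) (f g F : topdual V).

Local Notation Linf := (Linfty (mu S) (Omega_open S)).
Local Notation Hp := (Hpos S).
Local Notation i := (emb S).

Definition leH x y : Prop := cone_le Hp x y.
Definition itvH x y : set H := [set z | leH x z /\ leH z y].

Definition ppart x : H := proj_on Hp x.
Definition vppart v : V := xget 0 [set w | i w = ppart (i v)].
Definition vnpart v : V := vppart v - v.

Definition le_dual f g : Prop := forall v, Hp (i v) -> f v <= g v.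

(* The element of V' with which [h] in H = H' is identified. *)
Definition represents h f : Prop := forall v, f v = dotH S h (i v).

Definition Linfty_part (D : set (topdual V)) : set Linf :=
  [set z | exists2 f, D f & represents (embLinfty S z) f].

Section Operators.
Variable A : V -> topdual V.

Definition homogeneous1 : Prop :=
  forall (t : R) u v, 0 < t -> A (t *: u) v = t * A u v.

Definition lipschitz_op : Prop :=
  exists C : R, forall u v,
    dual_norm (fun w => A u w - A v w) <= C * `|u - v|.

Definition strongly_monotone : Prop :=
  exists2 c : R, 0 < c &
    forall u v, c * `|u - v| ^+ 2 <= A u (u - v) - A v (u - v).

Definition T_monotone : Prop :=
  forall u v, let w := vppart (u - v) in
    0 <= A u w - A v w /\ (A u w - A v w = 0 <-> w = 0).

End Operators.

Section QVI.
Variables (A : V -> topdual V) (Phi : H -> H) (ybar : V).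

Definition Phi_ext x : H := Phi (ppart x).

Definition increasing_on_Hpos : Prop :=
  (forall x, Hp x -> Hp (Phi x)) /\
  (forall x y, Hp x -> leH x y -> leH (Phi x) (Phi y)).

Definition constraint psi : set V := [set v | leH (i v) psi].

Definition QVI_sol f : set H :=
  [set h | exists y : V,
     [/\ i y = h, constraint (Phi_ext (i y)) y &
         forall v, constraint (Phi_ext (i y)) v ->
           0 <= A y (v - y) - f (v - y)]].

Definition Q_itv f : set H := QVI_sol f `&` itvH 0 (i ybar).

Definition min_sol f : V :=
  xget 0 [set y : V | Q_itv f (i y) /\ forall z, Q_itv f z -> leH (i y) z].

Definition max_sol f : V :=
  xget 0 [set y : V | Q_itv f (i y) /\ forall z, Q_itv f z -> leH z (i y)].

Definition is_sup (D : set H) s : Prop :=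
  (forall z, D z -> leH z s) /\
  (forall t, (forall z, D z -> leH z t) -> leH s t).

Definition is_inf (D : set H) s : Prop :=
  (forall z, D z -> leH s z) /\
  (forall t, (forall z, D z -> leH t z) -> leH t s).

Definition Tsup (D : set H) : H :=
  let E := D `&` itvH 0 (i ybar) in
  if pselect (E !=set0) then xget 0 (is_sup E) else 0.

Definition Tinf (D : set H) : H :=
  let E := D `&` itvH 0 (i ybar) in
  if pselect (E !=set0) then xget 0 (is_inf E) else i ybar.

(* [J1] is defined on V x V only, so the values of [Tsup] and [Tinf], which
   belong to V for every feasible set [QVI_sol f], are pulled back along [emb].
   *)
Definition to_V h : V := xget 0 [set v | i v = h].

End QVI.

Section Assumptions.
Variable Phi : H -> H.
Local Notation PhiV v := (Phi_ext Phi (i v)).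

Definition assumption_a (nu : R) : Prop :=
  forall (v_ : nat -> V) v, weak_cvg v_ v ->
    (exists (z_ : nat -> Linf) (z : Linf),
       [/\ forall n, PhiV (v_ n) = embLinfty S (z_ n), PhiV v = embLinfty S z,
           forall n, Linfty_ge nu (z_ n), Linfty_ge nu z & Linfty_cvg z_ z])
    \/
    (exists (w_ : nat -> V) w,
       [/\ forall n, PhiV (v_ n) = i (w_ n), PhiV v = i w & w_ @ \oo --> w]).

Definition assumption_b : Prop :=
  (forall (v_ : nat -> V) v, weak_cvg v_ v ->
     (fun n => PhiV (v_ n)) @ \oo --> PhiV v) /\
  (exists L : V -> topdual V,
     [/\ dual_linear L, dual_bounded L, strongly_monotone L,
         forall v, L (vnpart v) (vppart v) <= 0 &
         forall v, Hp (i v) -> exists w : V,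
           i w = Phi (i v) /\ forall u, Hp (i u) -> 0 <= L w u]).

Definition assumption_A (nu : R) : Prop := assumption_a nu \/ assumption_b.

Definition scaling_condition : Prop :=
  forall (lambda : R) y, 1 < lambda -> Hp y ->
    leH (Phi (lambda *: y)) (lambda *: Phi y).

End Assumptions.

Section Costs.
Variables (J2 : topdual V -> R) (U Uad : set (topdual V)).

(* [J2] is a function on V' of which only the restriction to L^oo(Omega), resp.
   to U, is constrained: these restrictions are the [j2] below. *)
Definition cost_on_Linfty : Prop :=
  exists j2 : Linf -> R,
    [/\ forall z f, represents (embLinfty S z) f -> J2 f = j2 z,
        Linfty_continuous j2, bounded_below j2 &
        Linfty_closed (Linfty_part Uad)].

Definition cost_on_reflexive : Prop :=
  exists (B : completeNormedModType R) (j : B -> topdual V) (j2 : B -> R),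
    [/\ [/\ dual_linear j, injective j, dual_bounded j & range j = U],
        reflexive_space B,
        [/\ forall b, J2 (j b) = j2 b, coercive j2, weakly_lsc j2 &
            bounded_below j2] &
        weakly_closed (j @^-1` Uad)].

End Costs.

End Problem.

(* Main.v *)
(** Let [m f] and [M f] be the smallest and largest solutions.  The solution map
    [S(f, psi)] of the obstacle problem is increasing in both arguments, so by
    Tarski's argument [M f] is the greatest [y] with [y <= S(f, Phi y)] and [m f]
    the least [y] with [S(f, Phi y) <= y].  If [g <= l f] with [l > 1], then
    homogeneity of [A] and [Phi (l y) <= l Phi y] make [M g / l] such a
    subsolution for [f] and [l (m f)] such a supersolution for [g]; hence
    [M g <= l (M f)] and [m g <= l (m f)].  If [f_n -> f] in [L^oo] and
    [f_n >= nu > 0], then [f_n <= (1 + e) f] and [f <= (1 + e) f_n] eventually,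
    so [m f_n -> m f] and [M f_n -> M f] strongly in [H].  These sequences are
    bounded in [V] and [H] is dense in [V'], so they converge weakly in [V].  The
    direct method applies; in the reflexive case, a minimizing sequence that is
    bounded in [U] and converges in [V'] converges weakly in [U], which gives the
    lower semicontinuity of [J2]. *)

Require Import Defs.
From HB Require Import structures.
From mathcomp Require Import all_boot all_order all_algebra.
From mathcomp Require Import all_classical all_reals all_analysis.
From mathcomp Require Import sesquilinear ess_sup_inf ring lra.

Set Implicit Arguments.
Unset Strict Implicit.
Unset Printing Implicit Defensive.

Import Order.TTheory GRing.Theory Num.Theory.
Import numFieldNormedType.Exports.

Local Open Scope classical_set_scope.
Local Open Scope ring_scope.

Lemma closed_seq (T : topologicalType) (K : set T) (x_ : nat -> T) (x : T) :
  closed K -> (forall n, K (x_ n)) -> x_ @ \oo --> x -> K x.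
Proof. by move=> Kc Kx; apply: (closed_cvg K Kc); exact: nearW. Qed.

Lemma convex_setP (R : numDomainType) (M : lmodType R) (K : set M) :
  convex_set K <->
  forall u v t, K u -> K v -> 0 <= t <= 1 -> K (t *: u + (1 - t) *: v).
Proof.
split=> [Kc u v t Ku Kv /andP[t0 t1]|Kc u v t].
  by apply/set_mem; apply: (Kc u v (Itv01 t0 t1)); exact/mem_set.
move=> /set_mem Ku /set_mem Kv; apply/mem_set; apply: Kc => //.
exact/andP.
Qed.

(** * Functionals and inner products *)

Section TopologicalDual.
Context {R : realType} {X : normedModType R}.
Implicit Types (f g : topdual X) (l : X -> R).

(** Beyond the underlying function both records hold only proofs, so proof irrelevance suffices. *)
Lemma topdual_ext f g : f =1 g -> f = g.
Proof.
case: f g => [f fc] [g gc] /= fg.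
have {}fg : f = g.
  case: f g {fc gc} fg => [f cf] [g cg] /= /funext fg.
  subst g; congr GRing.Linear.Pack.
  case: cf cg => [[a1] [b1]] [[a2] [b2]].
  by rewrite (Prop_irrelevance a1 a2) (Prop_irrelevance b1 b2).
by subst g; congr Dual; exact: Prop_irrelevance.
Qed.

Lemma topdualD f x y : f (x + y) = f x + f y.
Proof. exact: linearD. Qed.

Lemma topdualB f x y : f (x - y) = f x - f y.
Proof. exact: linearB. Qed.

Lemma topdualN f x : f (- x) = - f x.
Proof. exact: linearN. Qed.

Lemma topdualZ f a x : f (a *: x) = a * f x.
Proof. exact: linearZ. Qed.

Lemma topdual_of l (C : R) : scalar l -> (forall x, `|l x| <= C * `|x|) ->
  exists f : topdual X, forall x, f x = l x.
Proof.
move=> lin lC.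
pose L : {scalar X} := HB.pack l (GRing.isLinear.Build _ _ _ _ l lin).
have Lc : continuous (L : X -> R).
  apply: bounded_linear_continuous; apply/linear_boundedP.
  exists C; split; first exact: num_real.
  move=> r Cr x; apply: le_trans (lC x) _.
  by rewrite ler_wpM2r // ltW.
by exists (Dual Lc).
Qed.

Lemma topdual_bound f : exists2 C : R, 0 <= C & forall x, `|f x| <= C * `|x|.
Proof.
have /linear_boundedP[r [_ fr]] :
  bounded_near f (nbhs (0 : X)).
  by apply: continuous_linear_bounded; exact: dual_continuous.
exists (`|r| + 1); first by rewrite addr_ge0.
by move=> x; apply: fr; rewrite (le_lt_trans (ler_norm _)) // ltrDl.
Qed.

(** [topdual] carries no algebraic structure; linear combinations of functionals are produced
    through this existence statement. *)
Lemma topdual_comb (a : R) f g : exists h : topdual X, forall x, h x = a * f x + g x.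
Proof.
have [C _ fC] := topdual_bound f; have [D _ gD] := topdual_bound g.
apply: (@topdual_of (fun x => a * f x + g x) (`|a| * C + D)) => [b x y|x].
  rewrite !linearP /=; ring.
rewrite (le_trans (ler_normD _ _)) // mulrDl lerD // normrM -mulrA.
by rewrite ler_wpM2l.
Qed.

Lemma has_sup_dual_norm f :
  has_sup [set `|f x| | x in [set x : X | `|x| <= 1]].
Proof.
have [C C0 fC] := topdual_bound f; split.
  by exists `|f 0|, 0 => //=; rewrite normr0.
exists C => _ [y /= y1 <-]; rewrite (le_trans (fC y)) //.
by rewrite -[leRHS]mulr1 ler_wpM2l.
Qed.

Lemma dual_norm_ge0 f : 0 <= dual_norm f.
Proof.
apply: ub_le_sup; first exact: (has_sup_dual_norm f).2.
by exists 0 => /=; rewrite ?raddf0 normr0.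
Qed.

Lemma le_dual_norm f x : `|f x| <= dual_norm f * `|x|.
Proof.
have [->|x0] := eqVneq x 0; first by rewrite raddf0 !normr0 mulr0.
have nx : 0 < `|x| by rewrite normr_gt0.
rewrite -ler_pdivrMr //.
have -> : `|f x| / `|x| = `|f (`|x|^-1 *: x)|.
  by rewrite linearZ /= normrM normfV normr_id mulrC.
apply: ub_le_sup; first exact: (has_sup_dual_norm f).2.
by exists (`|x|^-1 *: x) => //=; rewrite normrZ normfV normr_id mulVf ?gt_eqF.
Qed.

End TopologicalDual.

Section InnerProduct.
Context {R : realType} {X : completeNormedModType R} (dot : {dot X for idfun}).
Hypothesis dot_norm : forall v : X, `|v| ^+ 2 = dot v v.

Lemma dotC u v : dot u v = dot v u.
Proof. by rewrite [LHS]hermitian_subproof /= expr0 mul1r. Qed.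

Lemma dotPr u a v w : dot u (a *: v + w) = a * dot u v + dot u w.
Proof. by rewrite linearD linearZ. Qed.

Lemma dotDr u v w : dot u (v + w) = dot u v + dot u w.
Proof. exact: linearD. Qed.

Lemma dotZr u a v : dot u (a *: v) = a * dot u v.
Proof. exact: linearZ. Qed.

Lemma dotBr u v w : dot u (v - w) = dot u v - dot u w.
Proof. exact: linearB. Qed.

Lemma dotDl u v w : dot (u + v) w = dot u w + dot v w.
Proof. by rewrite !(dotC _ w) dotDr. Qed.

Lemma dotZl u a v : dot (a *: v) u = a * dot v u.
Proof. by rewrite !(dotC _ u) dotZr. Qed.

Lemma dotBl u v w : dot (u - v) w = dot u w - dot v w.
Proof. by rewrite !(dotC _ w) dotBr. Qed.

Lemma dot0l u : dot 0 u = 0.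
Proof. by rewrite dotC linear0. Qed.

Lemma dot_ge0 u : 0 <= dot u u.
Proof. by rewrite -dot_norm sqr_ge0. Qed.

Lemma dot_eq0 u : dot u u = 0 -> u = 0.
Proof. by rewrite -dot_norm => /eqP; rewrite sqrf_eq0 normr_eq0 => /eqP. Qed.

(** Cauchy-Schwarz, from the nonnegative square of [|v| u - |u| v]. *)
Lemma dot_le u v : dot u v <= `|u| * `|v|.
Proof.
have [->|v0] := eqVneq v 0; first by rewrite linear0 normr0 mulr0.
have nv : 0 < `|v| by rewrite normr_gt0.
have := dot_ge0 (`|v| *: u - `|u| *: v).
rewrite !(dotBl, dotBr, dotZl, dotZr) -!dot_norm (dotC v u).
have [->|u0] := eqVneq u 0; first by rewrite dotC linear0 normr0 mul0r.
have nu : 0 < `|u| by rewrite normr_gt0.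
move: (dot u v) => d; move: nu nv; move: `|u| `|v| => a b a0 b0 h.
have ab0 : 0 < a * b by rewrite mulr_gt0.
rewrite -(ler_pM2l ab0) -subr_ge0; nra.
Qed.

Lemma dot_abs u v : `|dot u v| <= `|u| * `|v|.
Proof.
rewrite ler_norml dot_le andbT lerNl.
by have := dot_le (- u) v; rewrite normrN dotC linearN /= dotC.
Qed.

Lemma dot_topdual u : exists f : topdual X, forall v, f v = dot u v.
Proof.
by apply: (@topdual_of _ _ (dot u) `|u|) => [a x y|x]; [exact: dotPr|exact: dot_abs].
Qed.

Lemma dot_cvg u (x_ : nat -> X) x :
  x_ @ \oo --> x -> (fun n => dot u (x_ n)) @ \oo --> dot u x.
Proof.
have [f fE] := dot_topdual u => xx.
under eq_fun do rewrite -fE; rewrite -fE.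
exact: (cvg_comp _ _ xx (@dual_continuous _ _ f x)).
Qed.

Lemma cauchy_sqr (x_ : nat -> X) (e : nat -> R) :
  (forall n m, (n <= m)%N -> `|x_ n - x_ m| ^+ 2 <= e n) ->
  e @ \oo --> 0 -> cvgn x_.
Proof.
move=> xe e0; apply/cauchy_cvgP/cauchy_exP => r r0.
have r20 : 0 < r ^+ 2 by rewrite exprn_gt0.
have /cvgrPdist_lt /(_ _ r20) [N _ eN] := e0.
exists (x_ N); exists N => //= m Nm; rewrite -ball_normE /=.
have := eN N (leqnn N); rewrite /= sub0r normrN => /(le_lt_trans (ler_norm _)).
move=> /(le_lt_trans (xe _ _ Nm)).
by rewrite ltr_pXn2r // ?nnegrE // ltW.
Qed.

(* Minimize the energy [|v|^2 / 2 - f v] over [K]: by the parallelogram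
   identity minimizing sequences are Cauchy. *)
Lemma variational_inequality_dot (K : set X) (f : topdual X) :
  closed K -> convex_set K -> K !=set0 ->
  exists2 p, K p & forall v, K v -> f (v - p) <= dot p (v - p).
Proof.
move=> Kc /convex_setP Kconv [k0 Kk0].
have [C C0 fC] := topdual_bound f.
pose q v := dot v v / 2 - f v.
(* Complete the square in [|v|^2 / 2 - C |v|]. *)
have qlb v : - (C ^+ 2 / 2) <= q v.
  rewrite /q -dot_norm; have := fC v; rewrite ler_norml => /andP[_ h].
  have : 0 <= (`|v| - C) ^+ 2 by rewrite sqr_ge0.
  move: h; move: (f v) `|v| => a b; nra.
pose E := [set q v | v in K].
have Einf : has_inf E.
  split; first by exists (q k0), k0.
  by exists (- (C ^+ 2 / 2)) => _ [v _ <-].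
have sq v : K v -> inf E <= q v.
  by move=> Kv; apply: ge_inf; [exact: Einf.2|exists v].
have /choice[x_ xP] : forall n : nat, exists v, K v /\ q v < inf E + n.+1%:R^-1.
  move=> n; have [_ [v Kv <-] h] := @inf_adherent _ E n.+1%:R^-1 ltac:(by []) Einf.
  by exists v.
have mid u v : K u -> K v -> dot (u - v) (u - v) <= 4 * (q u + q v) - 8 * inf E.
  move=> Ku Kv.
  have /sq : K ((1/2) *: u + (1 - 1/2) *: v) by apply: Kconv => //; lra.
  rewrite /q !(dotBl, dotBr, dotDl, dotDr, dotZl, dotZr) (dotC v u).
  rewrite topdualD !topdualZ.
  lra.
have xc : cvgn x_.
  apply: (@cauchy_sqr _ (fun n => 8 * n.+1%:R^-1)).
    move=> n m nm; rewrite dot_norm.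
    apply: le_trans (mid _ _ (xP n).1 (xP m).1) _.
    have := (xP n).2; have := (xP m).2.
    have : (m.+1%:R^-1 : R) <= n.+1%:R^-1 by rewrite lef_pV2 ?posrE // ler_nat.
    move: (q _) (q _) (inf E) (_^-1) (_^-1) => ? ? ? ? ?; lra.
  rewrite -(mulr0 8); apply: cvgMr; exact: cvg_harmonic.
move: xc; set p := limn x_ => xc.
have Kp : K p by apply: closed_seq Kc _ xc => n; exact: (xP n).1.
have qc : (q \o x_) @ \oo --> q p.
  apply: cvgB; last exact: (cvg_comp _ _ xc (@dual_continuous _ _ f p)).
  apply: cvgMl; rewrite -dot_norm; under eq_fun do rewrite -dot_norm.
  by rewrite expr2; under eq_fun do rewrite expr2; apply: cvgM; exact: cvg_norm.
have qp : q p <= inf E.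
  have h : (fun n : nat => inf E + n.+1%:R^-1) @ \oo --> inf E.
    rewrite -[X in _ --> X]addr0; apply: cvgD; first exact: cvg_cst.
    exact: cvg_harmonic.
  by apply: (ler_cvg_to qc h); apply: nearW => n; exact: ltW (xP n).2.
exists p => // v Kv; rewrite leNgt; apply/negP => lt.
set d := v - p in lt *.
pose e := f d - dot p d; have e0 : 0 < e by rewrite /e subr_gt0.
have D0 := dot_ge0 d.
(* Moving from [p] by [t d] changes the energy by [- t e + t^2 |d|^2 / 2]. This [t] gives
   [t |d|^2 <= e], so the energy drops below its infimum; the summand [e] in the denominator keeps
   [t <= 1] and covers [d = 0]. *)
pose t := e / (e + dot d d).
have eD : 0 < e + dot d d by rewrite ltr_wpDr.
have t0 : 0 < t by rewrite divr_gt0.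
have t1 : t <= 1 by rewrite ler_pdivrMr // mul1r lerDl.
have tD : t * dot d d <= e.
  by rewrite mulrAC ler_pdivrMr // ler_pM2l // lerDr ltW.
have /sq : K (t *: v + (1 - t) *: p) by apply: Kconv => //; rewrite ltW.
have -> : t *: v + (1 - t) *: p = p + t *: d.
  by rewrite /d scalerBl scalerBr scale1r addrA addrAC [_ + p]addrC addrA.
rewrite /q => /(le_trans qp); clearbody d; rewrite /q topdualD topdualZ.
rewrite !(dotDl, dotDr, dotZl, dotZr) (dotC d p) => h.
clearbody t; have : t * e <= t * (t * dot d d) / 2.
  by rewrite /e; lra.
rewrite -mulrA ler_pM2l //; lra.
Qed.

End InnerProduct.

(** * Variational inequalities *)

Section LionsStampacchia.
Context {R : realType} {X : completeNormedModType R} (dot : {dot X for idfun}).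
Hypothesis dot_norm : forall v : X, `|v| ^+ 2 = dot v v.

(** On the whole space the variational inequality, tested at [u + v] and [u - v], becomes an
    equality. *)
Lemma riesz (f : topdual X) : exists u, forall v, f v = dot u v.
Proof.
have cT : convex_set [set: X] by apply/convex_setP.
have [u _ uP] := variational_inequality_dot dot_norm f closedT cT (ex_intro _ 0 I).
exists u => v; apply/eqP; rewrite eq_le; apply/andP; split.
  by have := uP (u + v) I; rewrite addrAC subrr add0r.
have := uP (u - v) I; rewrite addrAC subrr add0r.
by rewrite -scaleN1r topdualZ dotZr !mulN1r lerN2.
Qed.

(* The solutions are the fixed points of the contraction sending [u] to the
   projection on [K] of [u - rho (A u - f)], with [rho = c / L^2]. *)
Lemma variational_inequality (A : X -> topdual X) (K : set X) (f : topdual X)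
    (L0 c : R) : 0 < c ->
  (forall u v, dual_norm (fun w => A u w - A v w) <= L0 * `|u - v|) ->
  (forall u v, c * `|u - v| ^+ 2 <= A u (u - v) - A v (u - v)) ->
  closed K -> convex_set K -> K !=set0 ->
  exists2 p, K p & forall v, K v -> f (v - p) <= A p (v - p).
Proof.
move=> c0 AL0 Ac Kc Kconv K0.
(* The maximum makes [L] positive and [c / L <= 1], so that the contraction factor below is
   nonnegative. *)
pose L := Num.max L0 c.
have cL : c <= L by rewrite le_max lexx orbT.
have L_gt0 : 0 < L by exact: lt_le_trans cL.
have AL u v w : A u w - A v w <= L * `|u - v| * `|w|.
  have [g gE] := topdual_comb (-1) (A v) (A u).
  have -> : A u w - A v w = g w by rewrite gE mulN1r addrC.
  apply: le_trans (ler_norm _) _; apply: le_trans (le_dual_norm g w) _.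
  rewrite ler_wpM2r //; apply: le_trans (_ : L0 * `|u - v| <= _).
    suff <- : (fun w0 => A u w0 - A v w0) = g by exact: AL0.
    by apply/funext => x; rewrite gE mulN1r addrC.
  by rewrite ler_wpM2r // le_max lexx.
have /choice[B BE] : forall u, exists b, forall v, A u v = dot b v.
  by move=> u; exact: riesz.
have [r rE] := riesz f.
have /choice[P PP] : forall w, exists p,
    K p /\ forall v, K v -> dot w (v - p) <= dot p (v - p).
  move=> w; have [g gE] := dot_topdual dot_norm w.
  have [p Kp pP] := variational_inequality_dot dot_norm g Kc Kconv K0.
  by exists p; split => // v Kv; rewrite -gE; exact: pP.
pose rho := c / L ^+ 2.
have L2 : 0 < L ^+ 2 by rewrite exprn_gt0.
have rho0 : 0 < rho by rewrite divr_gt0.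
pose T u := P (u - rho *: (B u - r)).
(* The projection is nonexpansive: test the inequality of each image against the other image. *)
have PL w1 w2 : `|P w1 - P w2| <= `|w1 - w2|.
  have h1 := (PP w1).2 _ (PP w2).1; have h2 := (PP w2).2 _ (PP w1).1.
  have : `|P w1 - P w2| ^+ 2 <= `|w1 - w2| * `|P w1 - P w2|.
    apply: le_trans (dot_le dot_norm _ _); rewrite dot_norm.
    by move: h1 h2; rewrite !(dotBl, dotBr) (dotC _ (P w2) (P w1)); lra.
  have [->|n0] := eqVneq `|P w1 - P w2| 0; first by rewrite normr_ge0.
  by rewrite expr2 ler_pM2r // lt_neqAle eq_sym n0 /=.
have BL u v : `|B u - B v| <= L * `|u - v|.
  have : `|B u - B v| ^+ 2 <= L * `|u - v| * `|B u - B v|.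
    by rewrite dot_norm dotBl -!BE; exact: AL.
  have [->|n0] := eqVneq `|B u - B v| 0; first by rewrite mulr_ge0 // ltW.
  by rewrite expr2 ler_pM2r // lt_neqAle eq_sym n0 /=.
have q2 : 0 <= 1 - (c / L) ^+ 2.
  rewrite subr_ge0 expr_le1 ?divr_ge0 ?(ltW c0) ?(ltW L_gt0) //.
  by rewrite ler_pdivrMr // mul1r.
(* Expanding the square gives the factor [1 - 2 rho c + rho^2 L^2], which the choice of [rho]
   minimizes to [1 - (c / L)^2]. *)
have TL u v : `|T u - T v| ^+ 2 <= (1 - (c / L) ^+ 2) * `|u - v| ^+ 2.
  apply: le_trans (_ : _ <= `|(u - v) - rho *: (B u - B v)| ^+ 2) _.
    rewrite ler_pXn2r ?nnegrE //; apply: le_trans (PL _ _) _.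
    rewrite opprD opprK addrACA -[X in _ + X]opprK opprD opprK -scalerBr.
    by rewrite opprB addrA subrK.
  rewrite dot_norm; set d := u - v; set b := B u - B v.
  have db : c * `|d| ^+ 2 <= dot d b.
    by rewrite dotC dotBl -!BE; exact: Ac.
  have bb : `|b| ^+ 2 <= L ^+ 2 * `|d| ^+ 2.
    by rewrite -exprMn ler_pXn2r ?nnegrE ?mulr_ge0 ?(ltW L_gt0) //; exact: BL.
  clearbody d b; rewrite !(dotBl, dotBr, dotZl, dotZr) (dotC _ b d) -!dot_norm.
  have E1 : (c / L) ^+ 2 = rho * c by rewrite /rho; field; rewrite gt_eqF.
  have E2 : rho * L ^+ 2 = c by rewrite /rho; field; rewrite gt_eqF.
  rewrite E1; have := ler_wpM2l (ltW rho0) (ler_wpM2l (ltW rho0) bb).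
  rewrite (mulrA rho (L ^+ 2)) E2 => h.
  have := ler_wpM2l (ltW rho0) db; clearbody rho; lra.
have [p _ pT] : exists2 p, [set: X] p & p = T p.
  have TT : set_fun [set: X] [set: X] T by [].
  pose TF : {fun [set: X] >-> [set: X]} := HB.pack T (isFun.Build _ _ _ _ T TT).
  apply: (@banach_fixed_point _ _ _ TF) => //; last by exists 0.
  exists (NngNum (sqrtr_ge0 (1 - (c / L) ^+ 2))); split => /=.
    rewrite -[ltRHS]sqrtr1 ltr_sqrt // ltrBlDr ltrDl exprn_gt0 //.
    exact: divr_gt0.
  move=> [u v] _ /=.
  rewrite -(ler_pXn2r (ltn0Sn 1)) ?nnegrE ?mulr_ge0 ?sqrtr_ge0 //.
  by rewrite exprMn sqr_sqrtr.
exists p; first by rewrite pT; exact: (PP _).1.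
(* At a fixed point the terms [dot p (v - p)] cancel, and division by [rho] leaves the inequality
   for [A]. *)
move=> v Kv; have := (PP (p - rho *: (B p - r))).2 v Kv.
rewrite -/(T p) -pT BE rE dotBl lerBlDr lerDl dotZl pmulr_rge0 // dotBl.
by rewrite subr_ge0.
Qed.

End LionsStampacchia.

(** * Density of [H] in the dual of [V], and weak convergence in [V] *)

Section DenseDual.
Context {R : realType} {V H : completeNormedModType R}.
Variables (dotV : {dot V for idfun}) (dotH : {dot H for idfun}).
Hypothesis dotV_norm : forall v : V, `|v| ^+ 2 = dotV v v.
Hypothesis dotH_norm : forall x : H, `|x| ^+ 2 = dotH x x.
Variable emb : {linear V -> H}.
Hypothesis emb_inj : injective emb.
Hypothesis emb_cont : continuous emb.

Let emb_bound : exists C, forall v, `|emb v| <= C * `|v|.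
Proof.
have /linear_boundedP[r [_ er]] : bounded_near emb (nbhs (0 : V)).
  by apply: continuous_linear_bounded; exact: emb_cont.
exists (`|r| + 1) => v; apply: er.
by rewrite (le_lt_trans (ler_norm _)) // ltrDl.
Qed.

(** The inclusion of [H] in the dual of [V], through the inner product of [H]. *)
Lemma dot_emb_topdual h : exists f : topdual V, forall v, f v = dotH h (emb v).
Proof.
have [C eC] := emb_bound.
apply: (@topdual_of _ _ (fun v => dotH h (emb v)) (`|h| * C)) => [a u v|v].
  by rewrite linearP dotPr.
apply: le_trans (dot_abs dotH_norm _ _) _.
by rewrite -mulrA ler_wpM2l.
Qed.

(* Projecting onto the closure [K] of the Riesz representatives of [H] and using
   the injectivity of [emb] shows that [K] is all of [V]. *)
Lemma H_dense_in_dual (f : topdual V) e : 0 < e ->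
  exists h, forall v, `|f v - dotH h (emb v)| <= e * `|v|.
Proof.
pose K := [set u | forall e, 0 < e ->
  exists h, forall v, `|dotV u v - dotH h (emb v)| <= e * `|v|].
have Kcomb a u v : K u -> K v -> K (a *: u + v).
  move=> Ku Kv {}e e0.
  have a0 : 0 < `|a| + 1 by rewrite ltr_wpDl.
  have e2 : 0 < e / 2 by rewrite divr_gt0.
  have [h hP] := Ku (e / 2 / (`|a| + 1)) (divr_gt0 e2 a0).
  have [k kP] := Kv (e / 2) e2.
  exists (a *: h + k) => w; rewrite !dotDl !dotZl.
  have -> : a * dotV u w + dotV v w - (a * dotH h (emb w) + dotH k (emb w))
    = a * (dotV u w - dotH h (emb w)) + (dotV v w - dotH k (emb w)) by ring.
  apply: le_trans (ler_normD _ _) _; rewrite normrM [e]splitr mulrDl lerD //.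
  apply: le_trans (_ : (`|a| + 1) * (e / 2 / (`|a| + 1) * `|w|) <= _).
    by rewrite ler_pM // ?lerDl.
  by rewrite mulrA [_ * (e / 2 / _)]mulrC divfK // gt_eqF.
have K0 : K 0.
  by move=> {}e e0; exists 0 => v; rewrite !dot0l subrr normr0 mulr_ge0 // ltW.
have Kcl : closed K.
  move=> u clu {}e e0; have e2 : 0 < e / 2 by rewrite divr_gt0.
  have [u' [Ku' uu']] := clu _ (nbhsx_ballx u _ e2).
  have [h hP] := Ku' _ e2; exists h => v.
  have -> : dotV u v - dotH h (emb v) =
    dotV (u - u') v + (dotV u' v - dotH h (emb v)) by rewrite dotBl; ring.
  apply: le_trans (ler_normD _ _) _; rewrite [e]splitr mulrDl lerD //.
  apply: le_trans (dot_abs dotV_norm _ _) _.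
  rewrite ler_wpM2r //; apply: ltW.
  by move: uu'; rewrite -ball_normE.
have Kconv : convex_set K.
  apply/convex_setP => u v t Ku Kv _; apply: (Kcomb) => //.
  by rewrite -[_ *: v]addr0; exact: Kcomb.
have [r rE] := riesz dotV_norm f.
have [p Kp pP] := variational_inequality_dot dotV_norm f Kcl Kconv (ex_intro _ 0 K0).
(* [K] is a subspace, so both [p + w] and [p - w] are test points. *)
have fp w : K w -> f w = dotV p w.
  move=> Kw; apply/eqP; rewrite eq_le; apply/andP; split.
    have := pP _ (Kcomb 1 _ _ Kw Kp); rewrite scale1r addrK; exact.
  have := pP _ (Kcomb (-1) _ _ Kw Kp); rewrite scaleN1r addrK.
  by rewrite -scaleN1r topdualZ dotZr !mulN1r lerN2.
suff rp : r = p.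
  by move=> e0; have [h hP] := Kp _ e0; exists h => v; rewrite rE rp; exact: hP.
apply: emb_inj; apply/eqP; rewrite -subr_eq0; apply/eqP.
apply: (dot_eq0 dotH_norm); set h := emb r - emb p.
(* The representative [w] of [h] lies in [K]. Since [r] and [p] pair equally with [w], [h] is
   orthogonal to [emb r - emb p], which is [h] itself. *)
have [g gE] := dot_emb_topdual h; have [w wE] := riesz dotV_norm g.
have /fp : K w.
  by move=> {}e e0; exists h => v; rewrite -wE gE subrr normr0 mulr_ge0 // ltW.
rewrite rE !(dotC _ _ w) -!wE !gE => hE.
by rewrite {2}/h dotBr hE subrr.
Qed.

(** Up to a small multiple of the norm, [f] is the inner product with some [h] in [H]. The bound on
    [x_] controls the error and convergence in [H] handles the rest. *)
Lemma bounded_weak_cvg (f : topdual V) (x_ : nat -> V) x C :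
  (forall n, `|x_ n| <= C) -> (emb \o x_) @ \oo --> emb x ->
  (f \o x_) @ \oo --> f x.
Proof.
move=> xC xx; apply/cvgrPdist_lt => e e0.
have C1 : 0 < `|C| + `|x| + 1 by rewrite ltr_wpDl // addr_ge0.
have [h hP] := H_dense_in_dual f (divr_gt0 (divr_gt0 e0 (ltr0Sn _ 1)) C1).
have hx := dot_cvg dotH_norm (u := h) xx.
have e2 : 0 < e / 2 by rewrite divr_gt0.
have /cvgrPdist_lt/(_ _ e2) := hx; apply: filterS => n /= hn.
rewrite -topdualB.
have -> : f (x - x_ n) = (f (x - x_ n) - dotH h (emb (x - x_ n))) +
  (dotH h (emb x) - dotH h (emb (x_ n))) by rewrite -dotBr -linearB addrNK.
apply: le_lt_trans (ler_normD _ _) _; rewrite [e]splitr ler_ltD //.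
apply: le_trans (hP _) _.
rewrite -(mulrA (e / 2)) ler_piMr ?(ltW e2) // ler_pdivrMl // mulr1.
apply: le_trans (ler_normB _ _) _.
have := le_trans (xC n) (ler_norm C); lra.
Qed.

End DenseDual.

(** * Self-dual cones *)

Section SelfDualCone.
Context {R : realType} {H : completeNormedModType R} (dot : {dot H for idfun}).
Hypothesis dot_norm : forall x : H, `|x| ^+ 2 = dot x x.
Variable P : set H.
Hypothesis P_closed : closed P.
Hypothesis P_add : forall x y, P x -> P y -> P (x + y).
Hypothesis P_scale : forall (a : R) x, 0 <= a -> P x -> P (a *: x).
Hypothesis P_selfdual : P = [set v | forall y, P y -> 0 <= dot v y].
Hypothesis P_lattice : forall x y z,
  cone_le P x z -> cone_le P y z -> cone_le P (cone_sup P x y) z.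

Local Notation le := (cone_le P).
Local Notation pos := (proj_on P).
Implicit Types x y z t : H.

Lemma cone_dot_ge0 x y : P x -> P y -> 0 <= dot x y.
Proof. by move=> + Py; rewrite P_selfdual => /(_ _ Py). Qed.

Lemma cone_selfdualP x : (forall y, P y -> 0 <= dot x y) -> P x.
Proof. by move=> xP; rewrite P_selfdual. Qed.

Lemma cone0 : P 0.
Proof. by apply: cone_selfdualP => y _; rewrite dot0l. Qed.

Lemma cone_le_refl x : le x x.
Proof. by rewrite /cone_le subrr; exact: cone0. Qed.

Lemma cone_le_trans y x z : le x y -> le y z -> le x z.
Proof. by move=> xy yz; have := P_add yz xy; rewrite addrA subrK. Qed.

(** If [x - y] and its opposite both lie in the cone, their inner product [- |x - y|^2] is
    nonnegative. *)
Lemma cone_le_anti x y : le x y -> le y x -> x = y.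
Proof.
move=> xy yx; apply/eqP; rewrite -subr_eq0; apply/eqP/(dot_eq0 dot_norm).
apply/eqP; rewrite eq_le dot_ge0 // andbT -oppr_ge0.
by rewrite -mulN1r -dotZr scaleN1r opprB; exact: cone_dot_ge0.
Qed.

Lemma cone_ge0 x : le 0 x <-> P x.
Proof. by rewrite /cone_le subr0. Qed.

Lemma cone_le_subl z x y : le x y -> le (z - y) (z - x).
Proof. by rewrite /cone_le opprB [_ + (y - z)]addrC addrA subrK. Qed.

Lemma cone_le_scale (a : R) x y : 0 <= a -> le x y -> le (a *: x) (a *: y).
Proof. by rewrite /cone_le -scalerBr; exact: P_scale. Qed.

Lemma cone_le_closed (x_ y_ : nat -> H) x y :
  x_ @ \oo --> x -> y_ @ \oo --> y -> (forall n, le (x_ n) (y_ n)) -> le x y.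
Proof. by move=> xx yy h; apply: (closed_seq P_closed h); exact: cvgB. Qed.

(** [proj_on] is a choice among nearest points. The solution [p] of the variational inequality
    satisfies [pyth], which makes it the only nearest point. *)
Lemma proj_on_cone x :
  P (pos x) /\ forall v, P v -> dot x (v - pos x) <= dot (pos x) (v - pos x).
Proof.
have [f fE] := dot_topdual dot_norm x.
have Pconv : convex_set P.
  apply/convex_setP => u v t Pu Pv /andP[t0 t1].
  by apply: P_add; apply: P_scale => //; rewrite subr_ge0.
have [p Pp pP] := variational_inequality_dot dot_norm f P_closed Pconv
  (ex_intro _ 0 cone0).
have pyth v : P v -> `|x - p| ^+ 2 + `|v - p| ^+ 2 <= `|x - v| ^+ 2.
  move=> /pP; rewrite fE !dot_norm !(dotBl, dotBr) (dotC _ v p) (dotC _ v x).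
  by rewrite (dotC _ p x); lra.
have minp : P p /\ forall q, P q -> `|x - p| <= `|x - q|.
  split=> // q /pyth h; rewrite -(ler_pXn2r (ltn0Sn 1)) ?nnegrE //.
  by apply: le_trans h; rewrite lerDl sqr_ge0.
have [Pq qmin] : P (pos x) /\ forall q, P q -> `|x - pos x| <= `|x - q|.
  by rewrite /proj_on; case: xgetP => [y -> //|/(_ p)[]].
suff -> : pos x = p by split=> // v /pP; rewrite fE.
have := pyth _ Pq; have := qmin _ Pp.
rewrite -(ler_pXn2r (ltn0Sn 1)) ?nnegrE // => h1 h2.
apply/eqP; rewrite -subr_eq0 -normr_eq0 -sqrf_eq0 eq_le sqr_ge0 andbT.
have := le_trans h2 h1; rewrite -/(pos x); lra.
Qed.

Lemma pos_ge0 x : P (pos x).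
Proof. exact: (proj_on_cone x).1. Qed.

(** Testing the projection inequality at [pos x + y] puts [pos x - x] in the dual cone, which is the
    cone itself. *)
Lemma le_pos x : le x (pos x).
Proof.
apply: cone_selfdualP => y Py.
have := (proj_on_cone x).2 _ (P_add (pos_ge0 x) Py).
by rewrite addrAC subrr add0r dotBl subr_ge0.
Qed.

Lemma pos_id x : P x -> pos x = x.
Proof.
move=> Px; have := (proj_on_cone x).2 _ Px.
rewrite -subr_le0 -dotBl => h; apply/esym/eqP; rewrite -subr_eq0; apply/eqP.
by apply: (dot_eq0 dot_norm); apply/eqP; rewrite eq_le h dot_ge0.
Qed.

Lemma cone_supl x y : le x (cone_sup P x y).
Proof. by rewrite /cone_le /cone_sup addrAC subrr add0r; exact: pos_ge0. Qed.

Lemma cone_supr x y : le y (cone_sup P x y).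
Proof.
by have := le_pos (y - x); rewrite /cone_le /cone_sup opprB addrCA addrA.
Qed.

(** [pos x] is [cone_sup P 0 x], and [pos y] is an upper bound of [0] and [x]; the lattice
    hypothesis concludes. *)
Lemma pos_mono x y : le x y -> le (pos x) (pos y).
Proof.
move=> xy; have := P_lattice (proj2 (cone_ge0 _) (pos_ge0 y))
  (cone_le_trans xy (le_pos y)).
by rewrite /cone_sup subr0 add0r.
Qed.

(** The two sides differ by [2 dot (y - x) x]. Hence a norm-bounded increasing sequence in the cone
    is Cauchy. *)
Lemma cone_norm_sub x y : P x -> le x y -> `|y - x| ^+ 2 <= `|y| ^+ 2 - `|x| ^+ 2.
Proof.
move=> Px xy; have := cone_dot_ge0 xy Px.
by rewrite !dot_norm !(dotBl, dotBr) (dotC _ y x); lra.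
Qed.

Lemma cone_norm_le x y : P x -> le x y -> `|x| <= `|y|.
Proof.
move=> Px xy; rewrite -(ler_pXn2r (ltn0Sn 1)) ?nnegrE // -subr_ge0.
by apply: le_trans (cone_norm_sub Px xy); rewrite sqr_ge0.
Qed.

(* The subsolutions are stable under binary suprema and bounded, so an
   increasing sequence of them whose norms approach the supremum is Cauchy; its
   limit dominates all subsolutions. *)
Theorem greatest_fixed_point (T : H -> H) (b : H) :
  (forall x y, le x y -> le (T x) (T y)) ->
  (forall x, P (T x) /\ le (T x) b) ->
  exists s, T s = s /\ forall x, le x (T x) -> le x s.
Proof.
move=> Tmono Tb.
pose Z := [set x | P x /\ le x (T x)].
have Zsup x y : Z x -> le y (T y) -> Z (cone_sup P x y).
  move=> [Px xT] yT; split.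
    apply/cone_ge0/(cone_le_trans _ (cone_supl x y)); exact/cone_ge0.
  by apply: P_lattice; [apply: cone_le_trans xT _|apply: cone_le_trans yT _];
    apply: Tmono; [exact: cone_supl|exact: cone_supr].
have Z0 : Z 0 by split; [exact: cone0|apply/cone_ge0; exact: (Tb 0).1].
pose E := [set `|x| ^+ 2 | x in Z].
have Esup : has_sup E.
  split; first by exists (`|0 : H| ^+ 2), 0.
  exists (`|b| ^+ 2) => _ [x [Px xT] <-].
  rewrite ler_pXn2r ?nnegrE //; apply: cone_norm_le => //.
  exact: cone_le_trans xT (Tb x).2.
have supE x : Z x -> `|x| ^+ 2 <= sup E.
  by move=> Zx; apply: ub_le_sup; [exact: Esup.2|exists x].
have /choice[e eP] : forall n : nat, exists x, Z x /\ sup E - n.+1%:R^-1 < `|x| ^+ 2.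
  move=> n; have [_ [x Zx <-] h] := @sup_adherent _ E n.+1%:R^-1 ltac:(by []) Esup.
  by exists x.
(* Running suprema of the near-maximizers [e]: increasing, and with norms at least as large. *)
pose x_ := fix x_ n := if n is n'.+1 then cone_sup P (x_ n') (e n) else e 0%N.
have Zx n : Z (x_ n).
  elim: n => [|n IH] /=; first exact: (eP 0%N).1.
  by apply: Zsup => //; exact: (eP n.+1).1.2.
have xmono n m : (n <= m)%N -> le (x_ n) (x_ m).
  elim: m => [|m IH]; first by rewrite leqn0 => /eqP ->; exact: cone_le_refl.
  rewrite leq_eqVlt => /predU1P[->|/IH h]; first exact: cone_le_refl.
  exact: cone_le_trans h (cone_supl _ _).
have xlarge n : sup E - n.+1%:R^-1 < `|x_ n| ^+ 2.
  apply: lt_le_trans (eP n).2 _; rewrite ler_pXn2r ?nnegrE //.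
  apply: cone_norm_le; first exact: (eP n).1.1.
  by case: n => [|n] /=; [exact: cone_le_refl|exact: cone_supr].
have near_x n y : Z y -> le (x_ n) y -> `|y - x_ n| ^+ 2 <= n.+1%:R^-1.
  move=> Zy /(cone_norm_sub (Zx n).1) h; apply: le_trans h _.
  by rewrite lerBlDr (le_trans (supE _ Zy)) // -lerBlDl ltW.
have xc : cvgn x_.
  apply: (@cauchy_sqr _ _ _ (fun n => n.+1%:R^-1)); last exact: cvg_harmonic.
  by move=> n m nm; rewrite distrC; apply: near_x; [exact: Zx|exact: xmono].
move: xc; set x := limn x_ => xc.
(* Joining [z] to [x_ n] yields another element of [Z], whose squared distance to [x_ n] is at most
   [1 / (n + 1)]. So the joins also tend to [x], and they lie above [z]. *)
have ub z : le z (T z) -> le z x.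
  move=> zT.
  suff supc : (fun n => cone_sup P (x_ n) z) @ \oo --> x.
    apply: (cone_le_closed (cvg_cst z) supc) => n; exact: cone_supr.
  suff d0 : (fun n => cone_sup P (x_ n) z - x_ n) @ \oo --> 0.
    rewrite -[x]add0r; under eq_fun => n.
      rewrite -[cone_sup _ _ _](subrK (x_ n)); over.
    exact: cvgD.
  apply/cvgr0Pnorm_lt => r r0.
  have r2 : 0 < r ^+ 2 by rewrite exprn_gt0.
  have /cvgr0Pnorm_lt/(_ _ r2) := @cvg_harmonic R; apply: filterS => n /= hn.
  rewrite -(ltr_pXn2r (ltn0Sn 1)) ?nnegrE ?(ltW r0) //.
  apply: le_lt_trans (near_x n _ _ (cone_supl _ _)) _; first exact: Zsup.
  exact: le_lt_trans (ler_norm _) hn.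
(* Pass to the limit in [x_ n <= T (x_ n) <= T x]. Then [T x] is a subsolution too, so [ub] gives
   the reverse inequality. *)
have xT : le x (T x).
  apply: (cone_le_closed xc (cvg_cst (T x))) => n.
  apply: cone_le_trans (Zx n).2 _; apply: Tmono; apply: ub; exact: (Zx n).2.
exists x; split=> //; apply: cone_le_anti => //.
by apply: ub; exact: Tmono.
Qed.

(** The reflection [x] to [b - x] reverses the order and exchanges subsolutions with
    supersolutions. *)
Theorem least_fixed_point (T : H -> H) (b : H) :
  (forall x y, le x y -> le (T x) (T y)) ->
  (forall x, P (T x) /\ le (T x) b) ->
  exists s, T s = s /\ forall x, le (T x) x -> le s x.
Proof.
move=> Tmono Tb.
have [||s [Ts sP]] := @greatest_fixed_point (fun x => b - T (b - x)) b.
- by move=> x y xy; apply/cone_le_subl/Tmono/cone_le_subl.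
- move=> x; split; first exact: (Tb (b - x)).2.
  by rewrite /cone_le opprB addrA addrAC subrr add0r; exact: (Tb _).1.
exists (b - s); split; first by rewrite -{2}Ts opprB addrA addrAC subrr add0r.
move=> x xT; have /(cone_le_subl b) : le (b - x) s.
  apply: sP; rewrite opprB addrA addrAC subrr add0r; exact: cone_le_subl.
by rewrite opprB addrA addrAC subrr add0r.
Qed.

End SelfDualCone.

(** * The order of [H]: positive parts and convergence by squeezing *)

Section OrderOfH.
Context {R : realType} {N : nat} {S : qvi_setting R N}.
Local Notation V := (spaceV S).
Local Notation H := (spaceH S).
Local Notation Hp := (Hpos S).
Local Notation i := (emb S).
Implicit Types (x y z : H) (u v w : V).

Lemma leH_refl x : leH x x.
Proof. exact: (cone_le_refl (Hpos_selfdual S) _). Qed.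

Lemma leH_trans y x z : leH x y -> leH y z -> leH x z.
Proof. by move=> xy; exact: (cone_le_trans (@Hpos_add _ _ S) xy). Qed.

Lemma leH_anti x y : leH x y -> leH y x -> x = y.
Proof. exact: (cone_le_anti (dotH_norm S) (Hpos_selfdual S)). Qed.

Lemma leH0 x : leH 0 x <-> Hp x.
Proof. exact: cone_ge0. Qed.

Lemma Hpos_ppart x : Hp (ppart x).
Proof.
exact: (pos_ge0 (dotH_norm S) (Hpos_closed S) (@Hpos_add _ _ S)
  (@Hpos_scale _ _ S) (Hpos_selfdual S) x).
Qed.

Lemma le_ppart x : leH x (ppart x).
Proof.
exact: (le_pos (dotH_norm S) (Hpos_closed S) (@Hpos_add _ _ S)
  (@Hpos_scale _ _ S) (Hpos_selfdual S) x).
Qed.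

Lemma ppart_id x : Hp x -> ppart x = x.
Proof.
exact: (pos_id (dotH_norm S) (Hpos_closed S) (@Hpos_add _ _ S)
  (@Hpos_scale _ _ S) (Hpos_selfdual S)).
Qed.

Lemma ppart_mono x y : leH x y -> leH (ppart x) (ppart y).
Proof.
exact: (pos_mono (dotH_norm S) (Hpos_closed S) (@Hpos_add _ _ S)
  (@Hpos_scale _ _ S) (Hpos_selfdual S) (@Hpos_lattice _ _ S)).
Qed.

Lemma leH_norm x y : Hp x -> leH x y -> `|x| <= `|y|.
Proof. exact: (cone_norm_le (dotH_norm S) (Hpos_selfdual S)). Qed.

Lemma leH_scale (a : R) x y : 0 <= a -> leH x y -> leH (a *: x) (a *: y).
Proof. exact: (cone_le_scale (@Hpos_scale _ _ S)). Qed.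

Lemma emb_vppart v : i (vppart v) = ppart (i v).
Proof.
rewrite /vppart; case: xgetP => [w -> //|none].
by have [z zE] := ppart_V S v; have := none z.
Qed.

(** With [t = e (1 + e)] the hypotheses place [x_ n - x + t x] between [0] and [2 t x], where the
    norm is monotone. *)
Lemma leH_squeeze_cvg (x_ : nat -> H) x :
  (forall n, Hp (x_ n)) -> Hp x ->
  (forall e, 0 < e -> \forall n \near \oo,
     leH (x_ n) ((1 + e) *: x) /\ leH x ((1 + e) *: x_ n)) ->
  x_ @ \oo --> x.
Proof.
move=> x_0 x0 h; apply/cvgrPdist_lt => r r0.
(* The final estimate is [|x_ n - x| <= 3 t |x| <= 6 e |x|], using [e <= 1]; the [+ 1] covers
   [x = 0]. *)
have C0 : 0 < 6 * `|x| + 1 by rewrite ltr_wpDl // mulr_ge0.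
pose e := Num.min 1 (r / (6 * `|x| + 1)).
have e0 : 0 < e by rewrite lt_min ltr01 divr_gt0.
have e1 : e <= 1 by rewrite ge_min lexx.
have er : e * (6 * `|x|) < r.
  have : e <= r / (6 * `|x| + 1) by rewrite ge_min lexx orbT.
  by rewrite ler_pdivlMr // mulrDr mulr1; lra.
have := h _ e0; apply: filterS => n [h1 h2]; rewrite distrC.
pose t := e * (1 + e).
have t0 : 0 <= t by rewrite mulr_ge0 ?addr_ge0 // ltW.
have t2 : t <= 2 * e by rewrite /t mulrDr mulr1 mulr_natl mulr2n lerD2l ler_piMr // ltW.
have et : e <= t by rewrite /t mulrDr mulr1 lerDl mulr_ge0 // ltW.
set d := x_ n - x.
have lo : Hp (d + t *: x).
  have := @Hpos_scale _ _ S e _ (ltW e0) h1.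
  move=> /(Hpos_add S _ _ h2); rewrite /d /t; congr Hp.
  rewrite scalerBr scalerA scalerDl scale1r [x_ n + _ - x]addrAC -[LHS]addrA.
  by rewrite [_ *: x_ n + _]addrC subrK.
have up : leH (d + t *: x) ((2 * t) *: x).
  have tx : Hp ((t - e) *: x) by apply: Hpos_scale; rewrite ?subr_ge0.
  have := Hpos_add S _ _ h1 tx; rewrite /leH /cone_le /d; congr Hp.
  rewrite scalerDl scale1r scalerBl [x + _ - _]addrAC -[LHS]addrA.
  rewrite [_ *: x + (_ - _)]addrC subrK mulr_natl mulr2n scalerDl.
  by rewrite opprD opprB addrACA subrr addr0 addrC.
clearbody t; have := leH_norm lo up; rewrite normrZ ger0_norm ?mulr_ge0 // => dn.
have : `|d| <= `|d + t *: x| + `|t *: x|.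
  by rewrite -{1}[d](addrK (t *: x)); exact: ler_normB.
rewrite [`|t *: x|]normrZ ger0_norm // => dn2.
have := ler_wpM2r (normr_ge0 x) t2.
lra.
Qed.

End OrderOfH.

(** * Obstacle problems *)

Section ObstacleProblem.
Context {R : realType} {N : nat} {S : qvi_setting R N}.
Local Notation V := (spaceV S).
Local Notation H := (spaceH S).
Local Notation Hp := (Hpos S).
Local Notation i := (emb S).
Variable A : V -> topdual V.
Hypothesis A_hom : homogeneous1 A.
Hypothesis A_lip : lipschitz_op A.
Hypothesis A_mono : strongly_monotone A.
Hypothesis A_Tmono : T_monotone A.
Implicit Types (f g F : topdual V) (psi phi : H) (u v w y z : V).

(** The relation [y = S(f, psi)]. *)
Definition obstacle_sol f psi y :=
  constraint psi y /\ forall v, constraint psi v -> 0 <= A y (v - y) - f (v - y).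

Lemma homogeneous1_0 v : A 0 v = 0.
Proof.
have := A_hom 0 v (ltr0Sn R 1); rewrite scaler0.
by move: (A 0 v) => a; lra.
Qed.

Lemma constraint0 psi : Hp psi -> constraint psi 0.
Proof. by rewrite /constraint /= /leH /cone_le linear0 subr0. Qed.

Lemma obstacle_sol_exists f psi : Hp psi -> exists y, obstacle_sol f psi y.
Proof.
move=> psi0; case: A_lip => L AL; case: A_mono => c c0 Ac.
have Kc : closed (constraint psi).
  rewrite (_ : constraint psi = (fun v => psi - i v) @^-1` Hp) //.
  apply: closed_comp; last exact: Hpos_closed.
  move=> v _; apply: cvgB; [exact: cvg_cst|exact: emb_continuous].
have Kconv : convex_set (constraint psi).
  apply/convex_setP => u v t Ku Kv /andP[t0 t1].
  rewrite /constraint /= /leH /cone_le linearD !linearZ /=.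
  have -> : psi - (t *: i u + (1 - t) *: i v) =
    t *: (psi - i u) + (1 - t) *: (psi - i v).
    rewrite !scalerBr addrACA -opprD; congr (_ - _).
    by rewrite -scalerDl addrC subrK scale1r.
  by apply: Hpos_add; apply: Hpos_scale; rewrite ?subr_ge0.
have [y Ky yP] := variational_inequality (dotV_norm S) f c0 AL Ac Kc Kconv
  (ex_intro _ 0 (constraint0 psi0)).
by exists y; split=> // v Kv; rewrite subr_ge0; exact: yP.
Qed.

(** The equality case of T-monotonicity forces the positive part of [y - z] to vanish. *)
Lemma T_monotone_le y z :
  A y (vppart (y - z)) <= A z (vppart (y - z)) -> leH (i y) (i z).
Proof.
move=> yz; have [ge0 [eq0 _]] := A_Tmono y z.
have w0 : vppart (y - z) = 0.
  by apply: eq0; apply/eqP; rewrite eq_le ge0 subr_le0 yz.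
have := le_ppart (i (y - z)); rewrite -emb_vppart w0 linear0 linearB.
by rewrite /leH /cone_le sub0r opprB.
Qed.

(** The test point is the infimum [y - (y - z)^+], which lies below [y] and so below the
    obstacle. *)
Lemma obstacle_sol_test f psi y z : obstacle_sol f psi y ->
  A y (vppart (y - z)) <= f (vppart (y - z)).
Proof.
move=> [Ky yP]; set w := vppart _.
have := yP (y - w); rewrite [y - w - y]addrAC subrr sub0r !topdualN opprK.
rewrite [_ + f w]addrC subr_ge0.
apply; apply: leH_trans Ky; rewrite linearB /= /w emb_vppart.
rewrite /leH /cone_le opprB addrCA subrr addr0; exact: Hpos_ppart.
Qed.

(** The test point is the supremum [y + (z - y)^+], below the obstacle by the lattice hypothesis. *)
Lemma obstacle_sol_test_sup f psi y z : obstacle_sol f psi y -> constraint psi z ->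
  f (vppart (z - y)) <= A y (vppart (z - y)).
Proof.
move=> [Ky yP] Kz; set w := vppart _.
have := yP (y + w); rewrite [y + w - y]addrAC subrr add0r subr_ge0; apply.
rewrite /constraint /= linearD /= /w emb_vppart linearB /=.
exact: Hpos_lattice.
Qed.

(** With [w = (y - z)^+], the two tests give [A y w <= f w <= g w <= A z w]. Used in both
    directions, this also yields uniqueness. *)
Lemma obstacle_comparison f g psi phi y z :
  obstacle_sol f psi y -> obstacle_sol g phi z ->
  le_dual f g -> leH psi phi -> leH (i y) (i z).
Proof.
move=> yP zP fg pp; apply: T_monotone_le.
apply: le_trans (obstacle_sol_test z yP) _.
apply: le_trans (obstacle_sol_test_sup zP (leH_trans yP.1 pp)).
by apply: fg; rewrite emb_vppart; exact: Hpos_ppart.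
Qed.

Lemma obstacle_sol_le f psi y z :
  obstacle_sol f psi y -> le_dual f (A z) -> leH (i y) (i z).
Proof.
move=> yP fz; apply: T_monotone_le; apply: le_trans (obstacle_sol_test z yP) _.
by apply: fz; rewrite emb_vppart; exact: Hpos_ppart.
Qed.

Lemma obstacle_sol_ge0 f psi y : Hp psi -> (forall v, Hp (i v) -> 0 <= f v) ->
  obstacle_sol f psi y -> leH 0 (i y).
Proof.
move=> psi0 f0 yP; rewrite -(linear0 i); apply: T_monotone_le; rewrite homogeneous1_0.
apply: le_trans (obstacle_sol_test_sup yP (constraint0 psi0)).
by apply: f0; rewrite emb_vppart; exact: Hpos_ppart.
Qed.

Lemma obstacle_sol_scale (t : R) f g psi y : 0 < t ->
  (forall v, g v = t * f v) -> obstacle_sol f psi y ->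
  obstacle_sol g (t *: psi) (t *: y).
Proof.
move=> t0 gE [Ky yP]; split.
  by rewrite /constraint /= linearZ; apply: leH_scale; [exact: ltW|].
move=> v Kv; have := yP (t^-1 *: v).
have -> : v - t *: y = t *: (t^-1 *: v - y).
  by rewrite scalerBr scalerA divff ?scale1r // gt_eqF.
rewrite A_hom // gE !topdualZ -mulrBr -mulrBr => h.
rewrite !mulr_ge0 ?(ltW t0) //; apply: h.
rewrite /constraint /= linearZ /= -[psi](scalerK (lt0r_neq0 t0)).
by apply: leH_scale => //; rewrite invr_ge0 ltW.
Qed.

Lemma obstacle_sol_energy c f psi y :
  (forall u v, c * `|u - v| ^+ 2 <= A u (u - v) - A v (u - v)) ->
  Hp psi -> obstacle_sol f psi y -> c * `|y| ^+ 2 <= f y.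
Proof.
move=> Ac psi0 [_ yP]; have := Ac y 0; rewrite homogeneous1_0 !subr0 => h.
apply: le_trans h _; have := yP 0 (constraint0 psi0).
by rewrite sub0r !topdualN opprK addrC subr_ge0.
Qed.

End ObstacleProblem.

(** * Extremal solutions of the quasi-variational inequality *)

Section ExtremalSolutions.
Context {R : realType} {N : nat} {S : qvi_setting R N}.
Local Notation V := (spaceV S).
Local Notation H := (spaceH S).
Local Notation Hp := (Hpos S).
Local Notation i := (emb S).
Variable A : V -> topdual V.
Hypothesis A_hom : homogeneous1 A.
Hypothesis A_lip : lipschitz_op A.
Hypothesis A_mono : strongly_monotone A.
Hypothesis A_Tmono : T_monotone A.
Variable Phi : H -> H.
Hypothesis Phi_incr : increasing_on_Hpos Phi.
Variable ybar : V.
Implicit Types (f g : topdual V) (u v w y z : V) (x : H).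

Local Notation PhiE := (Phi_ext Phi).
Local Notation Q f := (Q_itv A Phi ybar f).

(** The condition [0 <= f <= F], with [F] written as [A ybar]. *)
Definition admissible f :=
  (forall v, Hp (i v) -> 0 <= f v) /\ le_dual f (A ybar).

Lemma Phi_ext_pos x : Hp (PhiE x).
Proof. exact/Phi_incr.1/Hpos_ppart. Qed.

Lemma Phi_ext_mono x x' : leH x x' -> leH (PhiE x) (PhiE x').
Proof. by move=> xx; apply: Phi_incr.2; [exact: Hpos_ppart|exact: ppart_mono]. Qed.

Lemma le_dual_refl f : le_dual f f.
Proof. by move=> v _. Qed.

(** For admissible loads every fixed point lies automatically between [0] and [ybar], by comparison
    with these two elements. *)
Lemma Q_itvP f y : admissible f ->
  Q f (i y) <-> obstacle_sol A f (PhiE (i y)) y.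
Proof.
move=> [f0 fF]; split=> [[[z [/emb_inj -> Kz zP]] _]|[Ky yP]]; first by split.
have yS : obstacle_sol A f (PhiE (i y)) y by split.
split; first by exists y.
split; last exact: obstacle_sol_le yS fF.
exact: obstacle_sol_ge0 (Phi_ext_pos _) f0 yS.
Qed.

(** The last two clauses bound all supersolutions from below and all subsolutions from above, not
    only solutions; the scaling lemmas rely on this. *)
Lemma extremal_solutions f : admissible f -> exists m M : V,
  [/\ Q f (i m), Q f (i M),
      forall x z, obstacle_sol A f (PhiE x) z -> leH (i z) x -> leH (i m) x &
      forall x z, obstacle_sol A f (PhiE x) z -> leH x (i z) -> leH x (i M)].
Proof.
move=> fadm; have [f0 fF] := fadm.
have /choice[s sP] : forall x, exists y, obstacle_sol A f (PhiE x) y.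
  by move=> x; apply: obstacle_sol_exists => //; exact: Phi_ext_pos.
pose T x := i (s x).
have Tmono x x' : cone_le Hp x x' -> cone_le Hp (T x) (T x').
  move=> xx; apply: (obstacle_comparison A_Tmono (sP x) (sP x')).
    exact: le_dual_refl.
  exact: Phi_ext_mono.
have Tb x : Hp (T x) /\ cone_le Hp (T x) (i ybar).
  split; last exact: obstacle_sol_le (sP x) fF.
  exact/leH0/(obstacle_sol_ge0 A_hom A_Tmono (Phi_ext_pos x) f0 (sP x)).
have sE x z : obstacle_sol A f (PhiE x) z -> i z = T x.
  move=> zP; apply: leH_anti.
    by apply: (obstacle_comparison A_Tmono zP (sP x)); [exact: le_dual_refl|exact: leH_refl].
  by apply: (obstacle_comparison A_Tmono (sP x) zP); [exact: le_dual_refl|exact: leH_refl].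
have [M [TM MP]] := greatest_fixed_point (dotH_norm S) (Hpos_closed S)
  (@Hpos_add _ _ S) (@Hpos_scale _ _ S) (Hpos_selfdual S) (@Hpos_lattice _ _ S)
  Tmono Tb.
have [m [Tm mP]] := least_fixed_point (dotH_norm S) (Hpos_closed S)
  (@Hpos_add _ _ S) (@Hpos_scale _ _ S) (Hpos_selfdual S) (@Hpos_lattice _ _ S)
  Tmono Tb.
exists (s m), (s M); split.
- by apply/Q_itvP => //; rewrite -/(T m) Tm.
- by apply/Q_itvP => //; rewrite -/(T M) TM.
- by move=> x z /sE ->; rewrite -/(T m) Tm; exact: mP.
- by move=> x z /sE ->; rewrite -/(T M) TM; exact: MP.
Qed.

Lemma max_solP f : admissible f ->
  Q f (i (max_sol A Phi ybar f)) /\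
  forall x z, obstacle_sol A f (PhiE x) z -> leH x (i z) ->
    leH x (i (max_sol A Phi ybar f)).
Proof.
move=> fadm; have [m [M [_ QM _ MP]]] := extremal_solutions fadm.
have Mmax (z : H) : Q f z -> leH z (i M).
  move=> Qz; case: (Qz) => [[y [yz _ _]] _]; move: Qz; rewrite -yz.
  by move=> /(Q_itvP _ fadm) yP; apply: (MP _ _ yP); exact: leH_refl.
suff -> : max_sol A Phi ybar f = M by [].
rewrite /max_sol; case: xgetP => [y -> [Qy yP]|/(_ M)[]//].
by apply: (@emb_inj _ _ S); apply: leH_anti; [exact: Mmax|exact: yP].
Qed.

Lemma min_solP f : admissible f ->
  Q f (i (min_sol A Phi ybar f)) /\
  forall x z, obstacle_sol A f (PhiE x) z -> leH (i z) x ->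
    leH (i (min_sol A Phi ybar f)) x.
Proof.
move=> fadm; have [m [M [Qm _ mP _]]] := extremal_solutions fadm.
have mmin (z : H) : Q f z -> leH (i m) z.
  move=> Qz; case: (Qz) => [[y [yz _ _]] _]; move: Qz; rewrite -yz.
  by move=> /(Q_itvP _ fadm) yP; apply: (mP _ _ yP); exact: leH_refl.
suff -> : min_sol A Phi ybar f = m by [].
rewrite /min_sol; case: xgetP => [y -> [Qy yP]|/(_ m)[]//].
by apply: (@emb_inj _ _ S); apply: leH_anti; [exact: yP|exact: mmin].
Qed.

Lemma Q_itv_solution f (z : H) : Q f z ->
  exists y, i y = z /\ obstacle_sol A f (PhiE z) y.
Proof. by move=> [[y [yz Ky yP]] _]; exists y; rewrite -yz; do !split. Qed.

Lemma max_sol_ub f (z : H) : admissible f -> Q f z ->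
  leH z (i (max_sol A Phi ybar f)).
Proof.
move=> fadm; have [_ MP] := max_solP fadm; move=> /Q_itv_solution[y [<- yP]].
by apply: (MP _ _ yP); exact: leH_refl.
Qed.

Lemma min_sol_lb f (z : H) : admissible f -> Q f z ->
  leH (i (min_sol A Phi ybar f)) z.
Proof.
move=> fadm; have [_ mP] := min_solP fadm; move=> /Q_itv_solution[y [<- yP]].
by apply: (mP _ _ yP); exact: leH_refl.
Qed.

(** The largest solution belongs to the set, so the set is nonempty and this element is its
    supremum; antisymmetry identifies it with the chosen one. *)
Lemma Tsup_QVI_sol f : admissible f ->
  Tsup ybar (QVI_sol A Phi f) = i (max_sol A Phi ybar f).
Proof.
move=> fadm; have [QM _] := max_solP fadm.
rewrite /Tsup /=; case: pselect => [?|[]]; last by exists (i (max_sol A Phi ybar f)).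
have Msup : is_sup (QVI_sol A Phi f `&` itvH 0 (i ybar))
    (i (max_sol A Phi ybar f)).
  by split=> [z|t]; [exact: max_sol_ub|exact].
case: xgetP => [s _ [sub slub]|/(_ _ Msup)//].
by apply: leH_anti; [exact: slub Msup.1|exact: sub].
Qed.

Lemma Tinf_QVI_sol f : admissible f ->
  Tinf ybar (QVI_sol A Phi f) = i (min_sol A Phi ybar f).
Proof.
move=> fadm; have [Qm _] := min_solP fadm.
rewrite /Tinf /=; case: pselect => [?|[]]; last by exists (i (min_sol A Phi ybar f)).
have minf : is_inf (QVI_sol A Phi f `&` itvH 0 (i ybar))
    (i (min_sol A Phi ybar f)).
  by split=> [z|t]; [exact: min_sol_lb|exact].
case: xgetP => [s _ [slb sglb]|/(_ _ minf)//].
by apply: leH_anti; [exact: slb|exact: sglb minf.1].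
Qed.

Lemma to_V_emb v : to_V (i v) = v.
Proof.
rewrite /to_V; case: xgetP => [w _ /emb_inj //|/(_ v)]; exact: contra_notP.
Qed.

Hypothesis Phi_scal : scaling_condition Phi.

Lemma max_sol_scaling (lambda : R) f g : 1 < lambda ->
  admissible f -> admissible g -> (forall v, Hp (i v) -> g v <= lambda * f v) ->
  leH (i (max_sol A Phi ybar g)) (lambda *: i (max_sol A Phi ybar f)).
Proof.
move=> l1 fadm gadm gf.
have l0 : 0 < lambda := lt_trans ltr01 l1.
set y := max_sol A Phi ybar g.
have Qy : Q g (i y) := (max_solP gadm).1.
have y0 : Hp (i y) by exact/leH0/(Qy.2.1).
(* The functional [g / lambda], written as [(1 / lambda - 1) g + g]. *)
have [h hE] := topdual_comb (lambda^-1 - 1) g g.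
have li0 : 0 < lambda^-1 by rewrite invr_gt0.
have hE' v : h v = lambda^-1 * g v by rewrite hE; ring.
have /(obstacle_sol_scale A_hom li0 hE') ySol := proj1 (Q_itvP _ gadm) Qy.
have [z zP] := obstacle_sol_exists A_lip A_mono f (Phi_ext_pos (lambda^-1 *: i y)).
have yl0 : Hp (lambda^-1 *: i y) by apply: Hpos_scale => //; exact: ltW.
suff h1 : leH (lambda^-1 *: i y) (i (max_sol A Phi ybar f)).
  by rewrite -[i y](scalerKV (lt0r_neq0 l0)); apply: leH_scale => //; exact: ltW.
(* [y / lambda] has load [g / lambda <= f] and obstacle [Phi y / lambda], which is below
   [Phi (y / lambda)] by the scaling condition at [y / lambda]. Comparison with [z] makes it a
   subsolution for [f]. *)
apply: ((max_solP fadm).2 _ _ zP); rewrite -linearZ.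
apply: (obstacle_comparison A_Tmono ySol zP).
  by move=> v v0; rewrite hE' ler_pdivrMl //; exact: gf.
rewrite /Phi_ext !ppart_id //.
have := Phi_scal l1 yl0; rewrite scalerKV ?lt0r_neq0 //.
by move=> /(leH_scale (ltW li0)); rewrite scalerK // lt0r_neq0.
Qed.

Lemma min_sol_scaling (lambda : R) f g : 1 < lambda ->
  admissible f -> admissible g -> (forall v, Hp (i v) -> g v <= lambda * f v) ->
  leH (i (min_sol A Phi ybar g)) (lambda *: i (min_sol A Phi ybar f)).
Proof.
move=> l1 fadm gadm gf.
have l0 : 0 < lambda := lt_trans ltr01 l1.
set y := min_sol A Phi ybar f.
have Qy : Q f (i y) := (min_solP fadm).1.
have y0 : Hp (i y) by exact/leH0/(Qy.2.1).
have [h hE] := topdual_comb (lambda - 1) f f.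
have hE' v : h v = lambda * f v by rewrite hE; ring.
have /(obstacle_sol_scale A_hom l0 hE') ySol := proj1 (Q_itvP _ fadm) Qy.
have [z zP] := obstacle_sol_exists A_lip A_mono g (Phi_ext_pos (lambda *: i y)).
have yl0 : Hp (lambda *: i y) by apply: Hpos_scale => //; exact: ltW.
apply: ((min_solP gadm).2 _ _ zP); rewrite -linearZ.
apply: (obstacle_comparison A_Tmono zP ySol).
  by move=> v v0; rewrite hE'; exact: gf.
by rewrite /Phi_ext !ppart_id //; exact: Phi_scal.
Qed.

(** As [y >= 0] and [f <= A ybar], the energy estimate gives [c |y|^2 <= f y <= A ybar y], a bound
    uniform in [f]. *)
Lemma solution_bound : exists C, forall f y, admissible f -> Q f (i y) -> `|y| <= C.
Proof.
case: A_mono => c c0 Ac; exists (`|dual_norm (A ybar)| / c) => f y fadm Qy.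
have y0 : Hp (i y) by exact/leH0/(Qy.2.1).
have := obstacle_sol_energy A_hom Ac (Phi_ext_pos _) (proj1 (Q_itvP _ fadm) Qy).
move=> /le_trans/(_ (fadm.2 _ y0)) /le_trans/(_ (ler_norm _)).
move=> /le_trans/(_ (le_dual_norm _ _)).
have [->|n0] := eqVneq `|y| 0.
  by move=> _; rewrite divr_ge0 // ltW.
rewrite expr2 mulrA ler_pM2r ?lt_def ?n0 ?normr_ge0 // => h.
by rewrite ler_pdivlMr // mulrC; apply: le_trans h _; exact: ler_norm.
Qed.

Lemma extremal_solutions_weak_cvg (f_ : nat -> topdual V) f :
  (forall n, admissible (f_ n)) -> admissible f ->
  (forall e, 0 < e -> \forall n \near \oo, forall v, Hp (i v) ->
     f_ n v <= (1 + e) * f v /\ f v <= (1 + e) * f_ n v) ->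
  weak_cvg (fun n => min_sol A Phi ybar (f_ n)) (min_sol A Phi ybar f) /\
  weak_cvg (fun n => max_sol A Phi ybar (f_ n)) (max_sol A Phi ybar f).
Proof.
move=> fnadm fadm fn; have [C CP] := solution_bound.
have e1 (e : R) : 0 < e -> 1 < 1 + e by rewrite ltrDl.
split=> g; apply: (bounded_weak_cvg (dotV_norm S) (dotH_norm S) (@emb_inj _ _ S)
  (@emb_continuous _ _ S) (C := C)) => [n|].
- by apply: (CP _ _ (fnadm n)); exact: (min_solP (fnadm n)).1.
- apply: leH_squeeze_cvg => [n||e e0].
  + exact/leH0/((min_solP (fnadm n)).1.2.1).
  + exact/leH0/((min_solP fadm).1.2.1).
  + have := fn _ e0; apply: filterS => n nP.
    by split; apply: min_sol_scaling; rewrite ?e1 // => v /nP[].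
- by apply: (CP _ _ (fnadm n)); exact: (max_solP (fnadm n)).1.
- apply: leH_squeeze_cvg => [n||e e0].
  + exact/leH0/((max_solP (fnadm n)).1.2.1).
  + exact/leH0/((max_solP fadm).1.2.1).
  + have := fn _ e0; apply: filterS => n nP.
    by split; apply: max_sol_scaling; rewrite ?e1 // => v /nP[].
Qed.

End ExtremalSolutions.

(** * Weak convergence and lower semicontinuity *)

Section WeakConvergence.
Context {R : realType}.

(** A functional on the product is the sum of its restrictions to the two factors. *)
Lemma weak_cvg_pair (X Y : normedModType R) (x_ : nat -> X) (y_ : nat -> Y) x y :
  weak_cvg x_ x -> weak_cvg y_ y ->
  weak_cvg (fun n => (x_ n, y_ n) : (X * Y)%type) (x, y).
Proof.
move=> xx yy g; have [C C0 gC] := topdual_bound g.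
have [g1 g1E] : exists g1 : topdual X, forall u, g1 u = g (u, 0).
  apply: (@topdual_of _ _ (fun u => g (u, 0)) C) => [a u v|u].
    rewrite -topdualZ -topdualD; congr (g _).
    by congr pair; rewrite /= scaler0 addr0.
  apply: le_trans (gC _) _; rewrite ler_wpM2l //.
  by rewrite prod_normE /= normr0 ge_max lexx normr_ge0.
have [g2 g2E] : exists g2 : topdual Y, forall u, g2 u = g (0, u).
  apply: (@topdual_of _ _ (fun u => g (0, u)) C) => [a u v|u].
    rewrite -topdualZ -topdualD; congr (g _).
    by congr pair; rewrite /= scaler0 addr0.
  apply: le_trans (gC _) _; rewrite ler_wpM2l //.
  by rewrite prod_normE /= normr0 ge_max lexx normr_ge0.
have gE u v : g (u, v) = g1 u + g2 v.
  rewrite g1E g2E -topdualD; congr (g _).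
  by congr pair; rewrite /= ?addr0 ?add0r.
rewrite gE; under eq_fun do rewrite gE.
by apply: cvgD; [exact: xx|exact: yy].
Qed.

Lemma weakly_lsc_near (X : normedModType R) (J : X -> R) (x_ : nat -> X) x e :
  weakly_lsc J -> weak_cvg x_ x -> 0 < e ->
  \forall n \near \oo, J x - e < J (x_ n).
Proof.
move=> Jlsc /Jlsc; rewrite limn_einf_lim.
rewrite (cvg_lim (@ereal_hausdorff R) (@cvg_einfs_sup R _)) => h e0.
have /ereal_sup_gt[_ [n _ <-] hn] : ((J x - e)%:E <
    ereal_sup (range (einfs (fun n => (J (x_ n))%:E))))%E.
  by apply: lt_le_trans h; rewrite lte_fin ltrBlDr ltrDl.
exists n => // m /= nm; rewrite -lte_fin; apply: lt_le_trans hn _.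
by apply: ereal_inf_lbound; exists m.
Qed.

(** For any set, its preimage or the complement of that preimage is in [F]; hence no proper filter
    is strictly finer than the image. *)
Lemma ultrafilter_map (T U : Type) (f : T -> U) (F : set_system T) :
  UltraFilter F -> UltraFilter (f @ F).
Proof.
move=> FU; have FP : ProperFilter F by exact: ultra_proper.
split; first exact: fmap_proper_filter.
move=> G GP FG; apply/seteqP; split=> // A GA.
have [//|FnA] := in_ultra_setVsetC (f @^-1` A) FU.
have /FG GnA : (f @ F) (~` A) by [].
by have [x []] := filter_ex (filterI GA GnA).
Qed.

Lemma ultrafilter_bounded_cvg (T : Type) (F : set_system T) (u : T -> R) C :
  UltraFilter F -> (forall t, `|u t| <= C) -> cvg (u @ F).
Proof.
move=> FU uC; have FP : ProperFilter F by exact: ultra_proper.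
have := @segment_compact R (- C) C; rewrite compact_ultra /=.
move=> /(_ (u @ F) (ultrafilter_map u FU)).
case=> [|x [_ ux]]; last by apply/cvg_ex; exists x.
by apply: (@filterE _ F) => t /=; rewrite in_itv /= -ler_norml; exact: uC.
Qed.

(* By reflexivity the limit of [b_] along any ultrafilter, seen as an element of
   the bidual, is a point [x]; as [j x = j b], this point is [b]. *)
Lemma reflexive_weak_cvg (B : completeNormedModType R) (V : normedModType R)
    (j : B -> topdual V) (b_ : nat -> B) b C :
  reflexive_space B -> dual_linear j -> injective j -> dual_bounded j ->
  (forall n, `|b_ n| <= C) ->
  (forall v, (fun n => j (b_ n) v) @ \oo --> j b v) -> weak_cvg b_ b.
Proof.
move=> Brefl jlin jinj [D jD] bC jb phi0.
apply/cvgrPdist_lt => e e0; apply: contrapT => nconv.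
pose bad := [set n | ~ `|phi0 b - phi0 (b_ n)| < e].
(* If convergence fails, the indices where [phi0] stays [e] away from the limit meet every tail; [U]
   is an ultrafilter concentrated on them. *)
have Wproper : ProperFilter (within bad \oo).
  apply: Build_ProperFilter => W0; apply: nconv.
  by move: W0; rewrite /within /=; apply: filterS => n /contrapT.
have [U [UU WU]] := ultraFilterLemma Wproper.
have UP : ProperFilter U by exact: ultra_proper.
have ooU : \oo `<=` U by move=> A Aoo; apply: WU; apply: filterS Aoo.
have phi_bound (phi : topdual B) n : `|phi (b_ n)| <= dual_norm phi * `|C|.
  apply: le_trans (le_dual_norm _ _) _.
  by rewrite ler_wpM2l ?dual_norm_ge0 // (le_trans (bC n)) // ler_norm.
pose G (phi : topdual B) : R := lim (phi (b_ n) @[n --> U]).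
have GP (phi : topdual B) : (fun n => phi (b_ n)) @ U --> G phi.
  exact: (ultrafilter_bounded_cvg (UU) (phi_bound phi)).
have GE (phi : topdual B) l : (fun n => phi (b_ n)) @ U --> l -> G phi = l.
  by move=> h; apply: cvg_lim.
have Glin (a : R) (f g h : topdual B) :
    (forall x, h x = a * f x + g x) -> G h = a * G f + G g.
  move=> hE; apply: GE; under eq_fun do rewrite hE.
  by apply: cvgD; [apply: cvgMr; exact: GP|exact: GP].
have Gbound : exists K : R, forall f : topdual B, `|G f| <= K * dual_norm f.
  exists `|C| => f; rewrite mulrC.
  apply: (ler_cvg_to (cvg_norm (GP f)) (cvg_cst (dual_norm f * `|C|))).
  by apply: filterE => n; exact: phi_bound.
have [x xG] := Brefl G Glin Gbound.
suff xb : x = b.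
  have : \forall n \near U, `|phi0 b - phi0 (b_ n)| < e.
    by have /cvgrPdist_lt/(_ _ e0) := GP phi0; rewrite xG xb.
  have : U bad by apply: WU; exact: withinT.
  by move=> h1 h2; have [n []] := filter_ex (filterI h1 h2).
(* Evaluation of [j] at [v] is a functional on [B], and its limit along [U] is [j b v] because [U]
   refines the filter of tails. *)
apply: jinj; apply: topdual_ext => v.
have [phi phiE] : exists phi : topdual B, forall a, phi a = j a v.
  apply: (@topdual_of _ _ (fun a => j a v) (D * `|v|)) => [a u w|u].
    exact: jlin.
  apply: le_trans (le_dual_norm _ _) _.
  by rewrite -mulrA [`|v| * _]mulrC mulrA ler_wpM2r.
rewrite -phiE -xG; apply: GE; under eq_fun do rewrite phiE.
by apply: cvg_trans (jb v); exact: cvg_app.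
Qed.

End WeakConvergence.

(** * From uniform convergence of functions to order bounds on functionals *)

Section Linfty.
Context {R : realType} {N : nat} {S : qvi_setting R N}.
Local Notation Linf := (Linfty (mu S) (Omega_open S)).
Local Notation V := (spaceV S).
Local Notation i := (emb S).

Lemma Linfty_norm_ae (z : Linf) :
  {ae restr_measure (mu S) (Omega_open S), forall x, `|z x| <= Linfty_norm z}.
Proof.
have zfin := @Lfunction_finite _ _ _ _ _ (leey 1) z.
rewrite /Linfty_norm; move: zfin; rewrite /finite_norm unlock /Lnorm.
(* The norm is an essential supremum only if the total measure is positive; otherwise every property
   holds almost everywhere. *)
case: ifPn => [mu0|mu0 _].
  move=> zfin.
  have := ess_sup_ge (restr_measure (mu S) (Omega_open S)) (abse \o (EFin \o z)).
  apply: filterS => x h; rewrite -lee_fin; apply: le_trans (h) _.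
  by rewrite fineK // ge0_fin_numE // (le_trans _ h) // abse_ge0.
exists setT; split; [exact: measurableT| |by []].
by apply/eqP; move: mu0; rewrite -leNgt measure_le0.
Qed.

Lemma Linfty_scaleE (a : R) (z : Linf) x : (a *: z) x = a * z x.
Proof. by []. Qed.

Lemma Linfty_subE (z w : Linf) x : (z - w) x = z x - w x.
Proof. by []. Qed.

Lemma embLinfty_ge0 (z : Linf) :
  {ae restr_measure (mu S) (Omega_open S), forall x, 0 <= z x} ->
  Hpos S (embLinfty S z).
Proof. by move=> z0; apply/embLinfty_order. Qed.

Lemma represents_cvg (z_ : nat -> Linf) z (f_ : nat -> topdual V) f v :
  (forall n, represents (embLinfty S (z_ n)) (f_ n)) ->
  represents (embLinfty S z) f -> Linfty_cvg z_ z ->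
  (fun n => f_ n v) @ \oo --> f v.
Proof.
move=> fz_ fz zz; have [C CP] := embLinfty_continuous S.
apply/cvgrPdist_lt => e e0.
pose K := `|C| * `|i v| + 1.
have K0 : 0 < K by rewrite ltr_wpDl // mulr_ge0.
have /cvgrPdist_lt/(_ _ (divr_gt0 e0 K0)) := zz; apply: filterS => n.
rewrite sub0r normrN => /(le_lt_trans (ler_norm _)); rewrite ltr_pdivlMr // => h.
rewrite fz fz_ distrC -dotBl -linearB.
apply: le_lt_trans (dot_abs (dotH_norm S) _ _) _.
apply: le_lt_trans h; rewrite /K.
have n0 : 0 <= Linfty_norm (z_ n - z) by rewrite fine_ge0 // Lnorm_ge0.
have := CP (z_ n - z).
move=> /le_trans/(_ (ler_wpM2r n0 (ler_norm C)))/(ler_wpM2r (normr_ge0 (i v))).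
by move/le_trans; apply; rewrite mulrDr mulr1 mulrAC mulrC lerDl.
Qed.

(** The lower bound [nu] turns an absolute error into a relative one: once
    [|z_ n - z| <= e nu / (1 + e)], each function is at most [1 + e] times the other. *)
Lemma represents_squeeze (nu : R) (z_ : nat -> Linf) z
    (f_ : nat -> topdual V) f e : 0 < nu -> 0 < e ->
  (forall n, Linfty_ge nu (z_ n)) ->
  (forall n, represents (embLinfty S (z_ n)) (f_ n)) ->
  represents (embLinfty S z) f -> Linfty_cvg z_ z ->
  \forall n \near \oo, forall v, Hpos S (i v) ->
    f_ n v <= (1 + e) * f v /\ f v <= (1 + e) * f_ n v.
Proof.
move=> nu0 e0 znu fz_ fz zz.
have e1 : 0 < 1 + e by rewrite addr_gt0.
have r0 : 0 < e * nu / (1 + e) by rewrite divr_gt0 // mulr_gt0.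
have /cvgrPdist_lt/(_ _ r0) := zz; apply: filterS => n.
rewrite sub0r normrN => /(le_lt_trans (ler_norm _)); rewrite ltr_pdivlMr // => h.
have aez := Linfty_norm_ae (z_ n - z); have aenu := znu n.
have P1 : Hpos S (embLinfty S ((1 + e) *: z - z_ n)).
  apply: embLinfty_ge0; apply: filterS2 aez aenu => x.
  rewrite !Linfty_subE Linfty_scaleE ler_norml.
  by move: h; move: (Linfty_norm _) (z x) (z_ n x) => a b c; nra.
have P2 : Hpos S (embLinfty S ((1 + e) *: z_ n - z)).
  apply: embLinfty_ge0; apply: filterS2 aez aenu => x.
  rewrite !Linfty_subE Linfty_scaleE ler_norml.
  by move: h; move: (Linfty_norm _) (z x) (z_ n x) => a b c; nra.
move=> v v0; have := cone_dot_ge0 (Hpos_selfdual S) P1 v0.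
have := cone_dot_ge0 (Hpos_selfdual S) P2 v0.
by rewrite !linearB /= !dotBl !linearZ /= !dotZl -fz -fz_ !subr_ge0.
Qed.

End Linfty.

(** * The direct method *)

Section Minimization.
Context {R : realType} {N : nat} {S : qvi_setting R N}.
Local Notation Linf := (Linfty (mu S) (Omega_open S)).
Local Notation V := (spaceV S).
Local Notation H := (spaceH S).
Local Notation i := (emb S).
Variables (J2 : topdual V -> R) (U Uad : set (topdual V)).
Hypothesis UadU : Uad `<=` U.
Hypothesis J2_cost : cost_on_Linfty J2 Uad \/ cost_on_reflexive J2 U Uad.

Lemma J2_lsc (z_ : nat -> Linf) z (f_ : nat -> topdual V) f alpha e :
  (forall n, Uad (f_ n)) -> Uad f ->
  (forall n, represents (embLinfty S (z_ n)) (f_ n)) ->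
  represents (embLinfty S z) f -> Linfty_cvg z_ z ->
  (forall n, J2 (f_ n) <= alpha) -> 0 < e ->
  \forall n \near \oo, J2 f - e < J2 (f_ n).
Proof.
move=> Uf_ Uf fz_ fz zz Ja e0; case: J2_cost => [[j2 [J2E j2c _ _]]|].
  have [d d0 dP] := j2c z _ e0.
  have /cvgrPdist_lt/(_ _ d0) := zz; apply: filterS => n.
  rewrite sub0r normrN => /(le_lt_trans (ler_norm _)) /dP.
  by rewrite (J2E _ _ (fz_ n)) (J2E _ _ fz) distrC ltr_norml => /andP[_]; lra.
move=> [B [j [j2 [[jlin jinj jb jU] Brefl [J2E j2coer j2lsc _] _]]]].
have /choice[b_ b_E] : forall n, exists b, j b = f_ n.
  move=> n; have : U (f_ n) by apply: UadU.
  by rewrite -jU => -[b _ <-]; exists b.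
have [b bE] : exists b, j b = f.
  by have := UadU Uf; rewrite -jU => -[b _ <-]; exists b.
(* Beyond radius [r] the cost is at least [alpha + 1], so sequences of cost at most [alpha] stay
   within the ball of radius [r]. *)
have [r rP] := j2coer (alpha + 1).
have bC n : `|b_ n| <= r.
  rewrite leNgt; apply/negP => /ltW /rP.
  by have := Ja n; rewrite -b_E J2E; lra.
have : weak_cvg b_ b.
  apply: (reflexive_weak_cvg Brefl jlin jinj jb bC) => v.
  rewrite bE; under eq_fun do rewrite b_E.
  exact: (represents_cvg fz_ fz zz).
move=> /(weakly_lsc_near j2lsc)/(_ e0).
by apply: filterS => n; rewrite -bE -b_E !J2E.
Qed.

Lemma J2_bounded_below : (forall f, Uad f ->
    exists z : Linf, represents (embLinfty S z) f) ->
  exists c, forall f, Uad f -> c <= J2 f.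
Proof.
move=> rep; case: J2_cost => [[j2 [J2E _ [c cP] _]]|].
  by exists c => f /rep[z fz]; rewrite (J2E _ _ fz).
move=> [B [j [j2 [[_ _ _ jU] _ [J2E _ _ [c cP]] _]]]].
by exists c => f /UadU; rewrite -jU => -[b _ <-]; rewrite J2E.
Qed.

Variables (nu : R) (adm : set (topdual V)).
Hypothesis nu_gt0 : 0 < nu.
Hypothesis Uad_rep : forall f, Uad f -> adm f /\
  exists2 z : Linf, Linfty_ge nu z & represents (embLinfty S z) f.
Hypothesis Uad0 : Uad !=set0.
Hypothesis Uad_compact : forall alpha : R, 0 < alpha ->
  Linfty_seq_compact (Linfty_part [set f : topdual V | Uad f /\ J2 f <= alpha]).

(** Stated for an arbitrary state map [p], so that it serves both orders of the smallest and largest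
    solutions. *)
Lemma minimizer_exists (J1 : (V * V)%type -> R) (p : topdual V -> (V * V)%type) :
  weakly_lsc J1 -> bounded_below J1 ->
  (forall (f_ : nat -> topdual V) f,
    (forall n, adm (f_ n)) -> adm f ->
    (forall e, 0 < e -> \forall n \near \oo, forall v, Hpos S (i v) ->
       f_ n v <= (1 + e) * f v /\ f v <= (1 + e) * f_ n v) ->
    weak_cvg (p \o f_) (p f)) ->
  exists f, is_minimizer Uad (fun g => J1 (p g) + J2 g) f.
Proof.
move=> J1lsc [c1 J1c1] pcont.
have [c2 J2c2] : exists c, forall f, Uad f -> c <= J2 f.
  by apply: J2_bounded_below => f /Uad_rep[_ [z _ ?]]; exists z.
pose J g := J1 (p g) + J2 g.
pose E := [set J g | g in Uad].
have Einf : has_inf E.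
  split; first by have [g Ug] := Uad0; exists (J g), g.
  by exists (c1 + c2) => _ [g Ug <-]; rewrite lerD // J2c2.
have infE g : Uad g -> inf E <= J g.
  by move=> Ug; apply: ge_inf; [exact: Einf.2|exists g].
have /choice[f_ f_P] : forall n : nat, exists g, Uad g /\ J g < inf E + n.+1%:R^-1.
  move=> n; have [_ [g Ug <-] h] := @inf_adherent _ E n.+1%:R^-1 ltac:(by []) Einf.
  by exists g.
have /choice[z_ z_P] : forall n, exists z : Linf,
    Linfty_ge nu z /\ represents (embLinfty S z) (f_ n).
  by move=> n; have [_ [z ? ?]] := Uad_rep (f_P n).1; exists z.
(* Minimizers up to [1 / (n + 1) <= 1] have [J2 < inf E + 1 - c1]; the maximum with [1] ensures
   positivity. *)
pose alpha := Num.max 1 (inf E + 1 - c1).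
have alpha0 : 0 < alpha by rewrite lt_max ltr01.
have J2alpha n : J2 (f_ n) <= alpha.
  rewrite le_max; apply/orP; right.
  have := (f_P n).2; have := J1c1 (p (f_ n)); rewrite /J.
  have : (n.+1%:R^-1 : R) <= 1 by rewrite invf_le1 // ler1n.
  by move: (J1 _) (J2 _) (inf E) (_^-1) => ? ? ? ?; lra.
have [phi [z [phi_incr [f [Uf _] fz] zz]]] := Uad_compact alpha0
  (fun n => ex_intro2 _ _ (f_ n) (conj (f_P n).1 (J2alpha n)) (z_P n).2).
exists f; split=> // g /infE; apply: le_trans.
have phi_ge n : (n <= phi n)%N.
  by elim: n => // n IH; apply: leq_ltn_trans IH (phi_incr _ _ (ltnSn n)).
have pcvg : weak_cvg (p \o (f_ \o phi)) (p f).
  apply: pcont => [n||e e0]; first exact: (Uad_rep (f_P _).1).1.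
    exact: (Uad_rep Uf).1.
  apply: (represents_squeeze nu_gt0 e0 _ _ fz zz) => n; [exact: (z_P _).1|exact: (z_P _).2].
(* One third of [e] each for the lower semicontinuity of [J1], that of [J2], and the gap to the
   infimum, which [n <= phi n] keeps small. *)
apply/ler_addgt0Pr => e e0; have e3 : 0 < e / 3 by rewrite divr_gt0.
have h1 := weakly_lsc_near J1lsc pcvg e3.
have h2 : \forall n \near \oo, J2 f - e / 3 < J2 (f_ (phi n)).
  apply: (J2_lsc _ Uf _ fz zz _ e3) => n; first exact: (f_P _).1.
    exact: (z_P _).2.
  exact: J2alpha.
have /cvgrPdist_lt/(_ _ e3) h3 := @cvg_harmonic R.
have [n [[/= n1 n2] n3]] := filter_ex (filterI (filterI h1 h2) h3).
have n4 : ((phi n).+1%:R^-1 : R) <= n.+1%:R^-1.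
  by rewrite lef_pV2 ?posrE // ler_nat ltnS.
move: n3; rewrite /= sub0r normrN => /(le_lt_trans (ler_norm _)).
have := (f_P (phi n)).2; rewrite /J; move: n1 n2 n4.
move: (inf E) (n.+1%:R^-1) ((phi n).+1%:R^-1) (J1 (p f)) (J2 f).
by move: (J1 _) (J2 _) => /= *; lra.
Qed.

End Minimization.

Theorem theorem6 (R : realType) (N : nat) (S : qvi_setting R N)
  (A : spaceV S -> topdual (spaceV S))
  (hA1 : homogeneous1 A) (hA2 : lipschitz_op A)
  (hA3 : strongly_monotone A) (hA4 : T_monotone A)
  (Phi : spaceH S -> spaceH S) (hPhi : increasing_on_Hpos Phi)
  (nu : R) (hnu : 0 < nu)
  (F : topdual (spaceV S))
  (hF : forall v : spaceV S, Hpos S (emb S v) -> 0 <= F v)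
  (ybar : spaceV S) (hybar : A ybar = F)
  (U Uad : set (topdual (spaceV S))) (hUad : Uad `<=` U) (hUad0 : Uad !=set0)
  (hUadF : forall f : topdual (spaceV S), Uad f ->
     (exists2 z : Linfty (mu S) (Omega_open S),
        Linfty_ge nu z & represents (embLinfty S z) f) /\ le_dual f F)
  (J1 : (spaceV S * spaceV S)%type -> R) (J2 : topdual (spaceV S) -> R)
  (hJ1 : weakly_lsc J1) (hJ1b : bounded_below J1)
  (hJ2 : cost_on_Linfty J2 Uad \/ cost_on_reflexive J2 U Uad)
  (hcompact : forall alpha : R, 0 < alpha ->
     Linfty_seq_compact
       (Linfty_part [set f : topdual (spaceV S) | Uad f /\ J2 f <= alpha]))
  (hA : assumption_A Phi nu) (hscal : scaling_condition Phi) :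
  (exists f : topdual (spaceV S),
     is_minimizer Uad
       (fun g => J1 (min_sol A Phi ybar g, max_sol A Phi ybar g) + J2 g) f) /\
  (exists p : (set (spaceH S) * topdual (spaceV S))%type,
     is_minimizer
       [set q : (set (spaceH S) * topdual (spaceV S))%type |
          [/\ U q.2, Uad q.2 & q.1 = QVI_sol A Phi q.2]]
       (fun q => J1 (to_V (Tsup ybar q.1), to_V (Tinf ybar q.1)) + J2 q.2) p).
Proof.
have Uad_adm f : Uad f -> admissible A ybar f /\
    exists2 z : Linfty (mu S) (Omega_open S),
      Linfty_ge nu z & represents (embLinfty S z) f.
  move=> /hUadF[[z znu fz] fF]; split; last by exists z.
  split=> [v v0|]; last by rewrite hybar.
  rewrite fz; apply: (cone_dot_ge0 (Hpos_selfdual S)) v0.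
  by apply: embLinfty_ge0; apply: filterS znu => x; exact/le_trans/ltW.
have minE := minimizer_exists hUad hJ2 hnu Uad_adm hUad0 hcompact.
split.
  apply: (minE J1 (fun g => (min_sol A Phi ybar g, max_sol A Phi ybar g))) => //.
  move=> f_ f f_adm fadm ff.
  by apply: weak_cvg_pair;
    have [] := extremal_solutions_weak_cvg hA1 hA2 hA3 hA4 hPhi hscal f_adm fadm ff.
(* Here [J1] receives the largest solution first, whereas the first problem has the smallest first;
   a separate minimizer is therefore taken. *)
have [f [Uf fmin]] :
    exists f, is_minimizer Uad
      (fun g => J1 (max_sol A Phi ybar g, min_sol A Phi ybar g) + J2 g) f.
  apply: (minE J1 (fun g => (max_sol A Phi ybar g, min_sol A Phi ybar g))) => //.
  move=> f_ f f_adm fadm ff.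
  by apply: weak_cvg_pair;
    have [] := extremal_solutions_weak_cvg hA1 hA2 hA3 hA4 hPhi hscal f_adm fadm ff.
have QE g : Uad g ->
    J1 (to_V (Tsup ybar (QVI_sol A Phi g)), to_V (Tinf ybar (QVI_sol A Phi g))) =
    J1 (max_sol A Phi ybar g, min_sol A Phi ybar g).
  move=> /Uad_adm[gadm _].
  by rewrite Tsup_QVI_sol // Tinf_QVI_sol // !to_V_emb.
exists (QVI_sol A Phi f, f); split; first by split => //; exact: hUad.
by move=> [D g] /= [_ Ug ->]; rewrite !QE //; exact: fmin.
Qed.
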